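(* Let $k$ be a field. There exists a unique exact category structure on the category $\mathsf{Top}^{\mathsf{sc}}_k$ which is maximal among all the exact structures having the property that the functors $\widehat\otimes^*$, $\widehat\otimes^{\leftarrow}$, and $\widehat\otimes^!\colon\mathsf{Top}^{\mathsf{sc}}_k\times\mathsf{Top}^{\mathsf{sc}}_k\to\mathsf{Top}^{\mathsf{sc}}_k$ are exact in it (as functors of any one argument with the topological vector space in the other argument fixed).
   Context: All topological $k$-vector spaces ($k$ a fixed field with the discrete topology) have linear topology: open vector subspaces form a base of neighborhoods of zero. The completion of $V$ is $V^{\wedge}=\varprojlim_{U\subset V}V/U$ over the open subspaces $U$, topologized so that the kernels of the projections $V^{\wedge}\to V/U$ form a base of neighborhoods of zero. $V$ is separated (resp. complete) if $V\to V^{\wedge}$ is injective (resp. surjective). $\mathsf{Top}^{\mathsf{sc}}_k$ is the additive category of complete, separated topological $k$-vector spaces and continuous $k$-linear maps. Exact category structures are in the sense of Quillen and are ordered by inclusion of their classes of short exact sequences. A functor is exact in an exact structure if it takes short exact sequences of that structure to short exact sequences of that structure. For topological vector spaces $U$ and $V$, three linear topologies on $U\otimes_kV$ are defined as follows; the resulting topological vector spaces are denoted by $U\otimes^*V$, $U\otimes^{\leftarrow}V$, $U\otimes^!V$. A subspace $E\subset U\otimes_kV$ is open in $U\otimes^*V$ if: there exist open subspaces $P\subset U$, $Q\subset V$ with $P\otimes_kQ\subset E$; for every $u\in U$ there is an open subspace $Q_u\subset V$ with $u\otimes Q_u\subset E$; and for every $v\in V$ there is an open subspace $P_v\subset U$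 with $P_v\otimes v\subset E$. A subspace $E$ is open in $U\otimes^{\leftarrow}V$ if: there exists an open subspace $P\subset U$ with $P\otimes_kV\subset E$; and for every $u\in U$ there is an open subspace $Q_u\subset V$ with $u\otimes Q_u\subset E$. A subspace $E$ is open in $U\otimes^!V$ if there exist open subspaces $P\subset U$, $Q\subset V$ with $P\otimes_kV+U\otimes_kQ\subset E$. For $\mathfrak U,\mathfrak V\in\mathsf{Top}^{\mathsf{sc}}_k$ put $\mathfrak U\,\widehat\otimes^*\,\mathfrak V=(\mathfrak U\otimes^*\mathfrak V)^{\wedge}$, $\mathfrak U\,\widehat\otimes^{\leftarrow}\,\mathfrak V=(\mathfrak U\otimes^{\leftarrow}\mathfrak V)^{\wedge}$, $\mathfrak U\,\widehat\otimes^!\,\mathfrak V=(\mathfrak U\otimes^!\mathfrak V)^{\wedge}$; on morphisms, these functors are the completions of $f\otimes g$. *)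

(* Defs.v *)
From HB Require Import structures.
From mathcomp Require Import all_boot all_order all_algebra.
From mathcomp Require Import generic_quotient ring_quotient.
From mathcomp Require Import all_classical.
From mathcomp Require Import topology.
From mathcomp Require Import freeg.

Set Implicit Arguments.
Unset Strict Implicit.
Unset Printing Implicit Defensive.

Import GRing.Theory.
Local Open Scope classical_set_scope.
Local Open Scope ring_scope.
Local Open Scope quotient_scope.

Record additive_category := AdditiveCategory {
  obj :> Type;
  hom : obj -> obj -> zmodType;
  idm : forall A, hom A A;
  comp : forall A B C, hom B C -> hom A B -> hom A C;
  compA : forall A B C D (h : hom C D) (g : hom B C) (f : hom A B),
    comp h (comp g f) = comp (comp h g) f;
  comp1m : forall A B (f : hom A B), comp (idm B) f = f;
  compm1 : forall A B (f : hom A B), comp f (idm A) = f;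
  compDl : forall A B C (g g' : hom B C) (f : hom A B),
    comp (g + g') f = comp g f + comp g' f;
  compDr : forall A B C (g : hom B C) (f f' : hom A B),
    comp g (f + f') = comp g f + comp g f';
  zero_object : exists Z : obj, idm Z = 0; (* so Z is initial and terminal *)
  biproduct : forall A B : obj, exists (P : obj)
      (iA : hom A P) (iB : hom B P) (pA : hom P A) (pB : hom P B),
    [/\ comp pA iA = idm A, comp pB iB = idm B, comp pA iB = 0,
        comp pB iA = 0 & comp iA pA + comp iB pB = idm P]
}.
Arguments hom {a} : rename.
Arguments idm {a} A : rename.
Arguments comp {a A B C} : rename.
Notation "g \oc f" := (comp g f) (at level 50, left associativity).

Section ExactStructures.
Variable C : additive_category.

Definition is_kernel (A B D : C) (i : hom A B) (p : hom B D) :=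
  p \oc i = 0 /\
  forall X (f : hom X B), p \oc f = 0 -> exists! g : hom X A, i \oc g = f.

Definition is_cokernel (A B D : C) (i : hom A B) (p : hom B D) :=
  p \oc i = 0 /\
  forall X (f : hom B X), f \oc i = 0 -> exists! g : hom D X, g \oc p = f.

Definition is_iso (A B : C) (f : hom A B) :=
  exists g : hom B A, g \oc f = idm A /\ f \oc g = idm B.

(* the square  b \oc f = a \oc g  is cocartesian *)
Definition is_pushout (A B A' B' : C) (f : hom A B) (g : hom A A')
    (a : hom A' B') (b : hom B B') :=
  b \oc f = a \oc g /\
  forall X (u : hom B X) (v : hom A' X), u \oc f = v \oc g ->
    exists! w : hom B' X, w \oc b = u /\ w \oc a = v.

(* the square  f \oc a = g \oc b  is cartesian *)
Definition is_pullback (B D D' B' : C) (f : hom B D) (g : hom D' D)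
    (a : hom B' B) (b : hom B' D') :=
  f \oc a = g \oc b /\
  forall X (u : hom X B) (v : hom X D'), f \oc u = g \oc v ->
    exists! w : hom X B', a \oc w = u /\ b \oc w = v.

(* A class of composable pairs A -i-> B -p-> D. *)
Definition seq_class := forall A B D : C, hom A B -> hom B D -> Prop.

Definition sub_class (E E' : seq_class) :=
  forall (A B D : C) (i : hom A B) (p : hom B D), E A B D i p -> E' A B D i p.

Definition maximal_among (P : seq_class -> Prop) (E : seq_class) :=
  P E /\ forall E', P E' -> sub_class E E' -> sub_class E' E.

Definition adm_mono (E : seq_class) (A B : C) (i : hom A B) :=
  exists (D : C) (p : hom B D), E A B D i p.

Definition adm_epi (E : seq_class) (B D : C) (p : hom B D) :=
  exists (A : C) (i : hom A B), E A B D i p.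

(* Quillen's axioms, in Buehler's formulation. *)
Record exact_structure (E : seq_class) : Prop := ExactStructure {
  ex_ker : forall A B D (i : hom A B) (p : hom B D),
    E A B D i p -> is_kernel i p;
  ex_coker : forall A B D (i : hom A B) (p : hom B D),
    E A B D i p -> is_cokernel i p;
  ex_iso : forall A B D A' B' D' (i : hom A B) (p : hom B D)
      (i' : hom A' B') (p' : hom B' D')
      (a : hom A A') (b : hom B B') (d : hom D D'),
    is_iso a -> is_iso b -> is_iso d ->
    b \oc i = i' \oc a -> d \oc p = p' \oc b ->
    E A B D i p -> E A' B' D' i' p';
  ex_mono1 : forall A, adm_mono E (idm A);
  ex_epi1 : forall A, adm_epi E (idm A);
  ex_monoM : forall A B D (g : hom B D) (f : hom A B),
    adm_mono E f -> adm_mono E g -> adm_mono E (g \oc f);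
  ex_epiM : forall A B D (g : hom B D) (f : hom A B),
    adm_epi E f -> adm_epi E g -> adm_epi E (g \oc f);
  ex_pushout : forall A B A' (f : hom A B) (g : hom A A'), adm_mono E f ->
    exists (B' : C) (a : hom A' B') (b : hom B B'),
      is_pushout f g a b /\ adm_mono E a;
  ex_pullback : forall B D D' (f : hom B D) (g : hom D' D), adm_epi E f ->
    exists (B' : C) (a : hom B' B) (b : hom B' D'),
      is_pullback f g a b /\ adm_epi E b
}.

Record endofunctor := Endofunctor {
  fobj :> C -> C;
  fmap : forall A B, hom A B -> hom (fobj A) (fobj B);
  fmap1 : forall A, fmap (idm A) = idm (fobj A);
  fmapM : forall A B D (g : hom B D) (f : hom A B),
    fmap (g \oc f) = fmap g \oc fmap f
}.

Definition exact_functor (E : seq_class) (F : endofunctor) :=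
  forall A B D (i : hom A B) (p : hom B D),
    E A B D i p -> E (F A) (F B) (F D) (fmap F i) (fmap F p).

End ExactStructures.

Section Subspaces.
Variables (k : fieldType) (V : lmodType k).

Lemma set_submod_closed (A : set V) :
  A 0 -> (forall c u v, A u -> A v -> A (c *: u + v)) ->
  submod_closed (fun x => `[< A x >]).
Proof.
move=> A0 AL; split; first exact/asboolP.
by move=> c u v /asboolP Au /asboolP Av; apply/asboolP/AL.
Qed.

Definition mk_submod (A : set V) (A0 : A 0)
    (AL : forall c u v, A u -> A v -> A (c *: u + v)) : submodClosed V :=
  HB.pack_for (submodClosed V) (fun x => `[< A x >])
    (GRing.isSubmodClosed.Build k V (fun x => `[< A x >])
       (set_submod_closed A0 AL)).

Lemma mem_mk_submod A A0 AL x : (x \in @mk_submod A A0 AL) <-> A x.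
Proof. by split=> [/asboolP|Ax]; last exact/asboolP. Qed.

Lemma submod_lin (P : submodClosed V) c u v :
  u \in P -> v \in P -> c *: u + v \in P.
Proof. by move=> uP vP; rewrite rpredD// rpredZ. Qed.

(* submodClosed, designed for semimodules, does not inherit from zmodClosed. *)
Definition submod_zmod (P : submodClosed V) : zmodClosed V :=
  HB.pack_for (zmodClosed V) (fun x => x \in P)
    (GRing.isZmodClosed.Build V (fun x => x \in P)
       (GRing.submod_closedB (submodClosedP P))).

Lemma submodB (P : submodClosed V) u v : u \in P -> v \in P -> u - v \in P.
Proof. exact: (@rpredB V (submod_zmod P)). Qed.
End Subspaces.

Section Quotients.
Variables (k : fieldType) (V : lmodType k) (P : submodClosed V).

Local Notation zquot := (Quotient.quot (submod_zmod P)).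

Definition vquot := zquot.
HB.instance Definition _ := GRing.Zmodule.on vquot.

Definition vproj (x : V) : vquot := \pi_zquot x.
Definition vrepr (q : vquot) : V := repr (q : zquot).

Lemma vprojP x y : vproj x = vproj y <-> x - y \in P.
Proof.
rewrite -[x - y \in P]/(x - y \in submod_zmod P) Quotient.idealrBE.
by split=> [e|/eqP//]; apply/eqP.
Qed.

Lemma vreprK q : vproj (vrepr q) = q.
Proof. exact: (reprK (q : zquot)). Qed.

Lemma vproj_surj (q : vquot) : exists x, q = vproj x.
Proof. by exists (vrepr q); rewrite vreprK. Qed.

Lemma vprojB : zmod_morphism vproj.
Proof. exact: (@raddfB _ _ \pi_zquot). Qed.
HB.instance Definition _ := GRing.isZmodMorphism.Build V vquot vproj vprojB.

Definition vquot_scale (c : k) (q : vquot) : vquot := vproj (c *: vrepr q).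

Lemma vproj_scale c x : vproj (c *: x) = vquot_scale c (vproj x).
Proof.
apply/vprojP; rewrite -scalerBr rpredZ//.
by apply/vprojP; rewrite vreprK.
Qed.

Lemma vqA a b (q : vquot) :
  vquot_scale a (vquot_scale b q) = vquot_scale (a * b) q.
Proof. by have [x ->] := vproj_surj q; rewrite -!vproj_scale scalerA. Qed.
Lemma vq1 (q : vquot) : vquot_scale 1 q = q.
Proof. by have [x ->] := vproj_surj q; rewrite -!vproj_scale scale1r. Qed.
Lemma vqDr a (q r : vquot) :
  vquot_scale a (q + r) = vquot_scale a q + vquot_scale a r.
Proof.
have [x ->] := vproj_surj q; have [y ->] := vproj_surj r.
by rewrite -raddfD -!vproj_scale scalerDr raddfD.
Qed.
Lemma vqDl (q : vquot) a b :
  vquot_scale (a + b) q = vquot_scale a q + vquot_scale b q.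
Proof.
by have [x ->] := vproj_surj q; rewrite -!vproj_scale scalerDl raddfD.
Qed.
HB.instance Definition _ :=
  GRing.Zmodule_isLmodule.Build k vquot vqA vq1 vqDr vqDl.

Lemma vprojZ : scalable vproj.
Proof. by move=> c x; rewrite vproj_scale. Qed.
HB.instance Definition _ := GRing.isScalable.Build k V vquot *:%R vproj vprojZ.

Lemma vproj0 x : vproj x = 0 <-> x \in P.
Proof. by rewrite -(raddf0 vproj) vprojP subr0. Qed.
End Quotients.

(* k is discrete, so continuity of the scaling k * V -> V amounts to continuity
   of each map v |-> c *: v.  The library's TopologicalLmodule is restricted to
   numDomainType scalars. *)
HB.mixin Record isLinTop (k : fieldType) V & Topological V & GRing.Lmodule k V := {
  add_continuous : continuous (fun x : V * V => x.1 + x.2);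
  scale_continuous : forall c : k, continuous (fun v : V => c *: v);
  nbhs0_open_submod : forall A : set V, nbhs (0 : V) A ->
    exists P : submodClosed V, open [set` P] /\ [set` P] `<=` A
}.

#[short(type="linTopType")]
HB.structure Definition LinTop (k : fieldType) :=
  {V of Topological V & GRing.Lmodule k V & isLinTop k V}.

(* The linear topology with a given filter base of subspaces as base of
   neighborhoods of zero. *)
HB.factory Record Lmodule_isLinTop (k : fieldType) V & GRing.Lmodule k V := {
  sbase : submodClosed V -> Prop;
  sbase_ex : exists P, sbase P;
  sbaseI : forall P Q, sbase P -> sbase Q ->
    exists R, [/\ sbase R, {subset R <= P} & {subset R <= Q}]
}.

HB.builders Context (k : fieldType) V & Lmodule_isLinTop k V.

Definition lin_nbhs (x : V) (A : set V) : Prop :=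
  exists P : submodClosed V, sbase P /\ forall v, v \in P -> A (x + v).

HB.instance Definition _ := hasNbhs.Build V lin_nbhs.

Let nbhs_pf (x : V) : ProperFilter (nbhs x).
Proof.
split; last split.
- by move=> [P [_ /(_ 0 (rpred0 _))]].
- by have [P bP] := sbase_ex; exists P.
- move=> A B [P [bP AP]] [Q [bQ BQ]]; have [R [bR RP RQ]] := sbaseI bP bQ.
  by exists R; split=> // v vR; split; [apply/AP/RP|apply/BQ/RQ].
- by move=> A B AB [P [bP AP]]; exists P; split=> // v /AP/AB.
Qed.

Let nbhs_sing (x : V) (A : set V) : nbhs x A -> A x.
Proof. by move=> [P [_ /(_ 0 (rpred0 _))]]; rewrite addr0. Qed.

Let nbhs_nbhs (x : V) (A : set V) : nbhs x A -> nbhs x (nbhs^~ A).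
Proof.
move=> [P [bP AP]]; exists P; split=> // v vP; exists P; split=> // w wP.
by rewrite -addrA; apply: AP; rewrite rpredD.
Qed.

HB.instance Definition _ :=
  Nbhs_isNbhsTopological.Build V nbhs_pf nbhs_sing nbhs_nbhs.

Let lin_add_continuous : continuous (fun x : V * V => x.1 + x.2).
Proof.
move=> [x y] A [P [bP AP]].
exists ([set x + v | v in [set` P]], [set y + v | v in [set` P]]).
  by split; exists P; split=> // v vP; exists v.
move=> [_ _] /= [[v vP <-] [w wP <-]].
by rewrite /= addrACA; apply/AP; exact: (rpredD vP wP).
Qed.

Let lin_scale_continuous (c : k) : continuous (fun v : V => c *: v).
Proof.
move=> x A [P [bP AP]]; exists P; split=> // v vP.
by rewrite /= scalerDr; apply: AP; rewrite rpredZ.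
Qed.

Let lin_base (A : set V) : nbhs (0 : V) A ->
  exists P : submodClosed V, open [set` P] /\ [set` P] `<=` A.
Proof.
move=> [P [bP AP]]; exists P; split; last by move=> v /AP; rewrite add0r.
rewrite openE => x xP; exists P; split=> // v vP.
exact: (rpredD xP vP).
Qed.

HB.instance Definition _ :=
  isLinTop.Build k V lin_add_continuous lin_scale_continuous lin_base.
HB.end.

Section LinTopTheory.
Variables (k : fieldType) (V : linTopType k).

Lemma nbhs_addr (x : V) (A : set V) : nbhs (0 : V) A -> nbhs x [set y | A (y - x)].
Proof.
move=> A0; suff : (fun y : V => y - x) @ x --> (0 : V) by apply.
rewrite -(subrr x); apply: (@continuous_comp _ _ _ (fun y => (y, - x))
  (fun z : V * V => z.1 + z.2)); last exact: add_continuous.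
by apply: cvg_pair => /=; [exact: cvg_id|exact: cvg_cst].
Qed.

Lemma open_submod_nbhs (P : submodClosed V) :
  nbhs (0 : V) [set` P] -> open [set` P].
Proof.
move=> P0; rewrite openE => x xP; apply: filterS (nbhs_addr x P0) => y /= yxP.
by rewrite -(subrK x y); exact: (rpredD yxP xP).
Qed.

Lemma open_submodS (P Q : submodClosed V) :
  open [set` P] -> {subset P <= Q} -> open [set` Q].
Proof.
move=> oP PQ; apply: open_submod_nbhs; apply: (@filterS _ _ _ [set` P]) => //.
by apply: open_nbhs_nbhs; split=> //; exact: rpred0.
Qed.

Record open_submod := OpenSubmod {
  osubmod :> submodClosed V;
  osubmod_open : open [set` osubmod]
}.

Lemma open_submodI (P Q : open_submod) :
  exists R : open_submod, {subset R <= P} /\ {subset R <= Q}.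
Proof.
have : nbhs (0 : V) ([set` P] `&` [set` Q]).
  by apply: filterI; apply: open_nbhs_nbhs; split;
    rewrite /= ?rpred0//; exact: osubmod_open.
move=> /nbhs0_open_submod[R [oR RPQ]]; exists (OpenSubmod oR).
by split=> x xR; have [] := RPQ x xR.
Qed.

Lemma open_submodT : exists R : open_submod, True.
Proof.
have V0 : nbhs (0 : V) [set: V] by exact: filterT.
by have [R [oR _]] := nbhs0_open_submod _ V0; exists (OpenSubmod oR).
Qed.
End LinTopTheory.

Section LinearMaps.
Variable k : fieldType.

Lemma linear_continuousP (V W : linTopType k) (f : {linear V -> W}) :
  continuous f <->
  forall Q : open_submod W, exists P : open_submod V, forall x, x \in P -> f x \in Q.
Proof.
split=> [cf Q|fPQ x A].
  have : nbhs (0 : V) (f @^-1` [set` Q]).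
    apply: cf; apply: open_nbhs_nbhs; split; first exact: osubmod_open.
    by rewrite /= raddf0 rpred0.
  by move=> /nbhs0_open_submod[P [oP PQ]]; exists (OpenSubmod oP).
move=> fxA; have : nbhs (0 : W) [set v | A (f x + v)].
  
  suff : (fun v : W => f x + v) @ (0 : W) --> f x by apply.
  rewrite -[X in _ --> X]addr0; apply: (@continuous_comp _ _ _ (fun y => (f x, y))
    (fun z : W * W => z.1 + z.2)); last exact: add_continuous.
  by apply: cvg_pair => /=; [exact: cvg_cst|exact: cvg_id].
move=> /nbhs0_open_submod[Q [oQ QA]]; have [P PQ] := fPQ (OpenSubmod oQ).
have P0 : nbhs (0 : V) [set` P].
  by apply: open_nbhs_nbhs; split; [exact: osubmod_open|exact: rpred0].
apply: filterS (nbhs_addr x P0) => y /= /PQ/QA /=.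
by rewrite linearB addrC subrK.
Qed.

Lemma preim_submod_closed (V W : linTopType k) (f : {linear V -> W})
  (Q : submodClosed W) : submod_closed (fun x => f x \in Q).
Proof.
split; first by rewrite unfold_in/= raddf0 rpred0.
by move=> c u v; rewrite !unfold_in/= linearP => fu fv; exact: submod_lin.
Qed.

Definition preim_submod (V W : linTopType k) (f : {linear V -> W})
    (Q : submodClosed W) : submodClosed V :=
  HB.pack_for (submodClosed V) (fun x => f x \in Q)
    (GRing.isSubmodClosed.Build k V (fun x => f x \in Q)
       (preim_submod_closed f Q)).

Lemma mem_preim_submod (V W : linTopType k) (f : {linear V -> W})
  (Q : submodClosed W) x : (x \in preim_submod f Q) = (f x \in Q).
Proof. by []. Qed.

Record lcmap (V W : linTopType k) := LCMap {
  lcmap_lin :> {linear V -> W};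
  lcmap_continuous : continuous lcmap_lin
}.

Definition preim_open (V W : linTopType k) (f : lcmap V W) (Q : open_submod W)
  : open_submod V :=
  @OpenSubmod k V (preim_submod f Q)
    (proj1 (continuousP _) (@lcmap_continuous _ _ f) _ (osubmod_open Q)).

Lemma linear_eqP (V W : lmodType k) (f g : {linear V -> W}) : f =1 g -> f = g.
Proof.
case: f g => [f [[fA] [fZ]]] [g [[gA] [gZ]]] /= /funext fg; subst g.
by rewrite (Prop_irrelevance fA gA) (Prop_irrelevance fZ gZ).
Qed.

Lemma lcmapP (V W : linTopType k) (f g : lcmap V W) : f =1 g -> f = g.
Proof.
case: f g => [f cf] [g cg] /= /linear_eqP fg; subst g.
by rewrite (Prop_irrelevance cf cg).
Qed.

Section LcmapZmod.
Variables V W : linTopType k.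

HB.instance Definition _ := gen_eqMixin (lcmap V W).
HB.instance Definition _ := gen_choiceMixin (lcmap V W).

Lemma lin0_cont : continuous (\0 : V -> W).
Proof. by move=> x; exact: cst_continuous. Qed.
Definition lcmap0 := LCMap lin0_cont.

Lemma linN_cont (f : lcmap V W) : continuous (\- f : V -> W).
Proof.
have e : (\- f : V -> W) = ( *:%R (-1)) \o f.
  by apply/funext => y /=; rewrite scaleN1r.
rewrite e => x; apply: continuous_comp; first exact: lcmap_continuous.
exact: scale_continuous.
Qed.
Definition lcmapN (f : lcmap V W) := LCMap (@linN_cont f).

Lemma linD_cont (f g : lcmap V W) : continuous (f \+ g : V -> W).
Proof.
move=> x; apply: (@continuous_comp _ _ _ (fun y => (f y, g y))
  (fun z : W * W => z.1 + z.2)); last exact: add_continuous.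
by apply: cvg_pair; exact: lcmap_continuous.
Qed.
Definition lcmapD (f g : lcmap V W) := LCMap (@linD_cont f g).

Lemma lcDA : associative lcmapD.
Proof. by move=> f g h; apply/lcmapP => x /=; rewrite addrA. Qed.
Lemma lcDC : commutative lcmapD.
Proof. by move=> f g; apply/lcmapP => x /=; rewrite addrC. Qed.
Lemma lc0D : left_id lcmap0 lcmapD.
Proof. by move=> f; apply/lcmapP => x /=; rewrite add0r. Qed.
Lemma lcND : left_inverse lcmap0 lcmapN lcmapD.
Proof. by move=> f; apply/lcmapP => x /=; rewrite addNr. Qed.
HB.instance Definition _ := GRing.isZmodule.Build (lcmap V W) lcDA lcDC lc0D lcND.
End LcmapZmod.

Lemma id_cont (V : linTopType k) : continuous (idfun : V -> V).
Proof. by move=> x; exact: cvg_id. Qed.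
Definition lcmap1 (V : linTopType k) : lcmap V V := LCMap (@id_cont V).

Lemma comp_cont (U V W : linTopType k) (g : lcmap V W) (f : lcmap U V) :
  continuous (g \o f).
Proof. by move=> x; apply: continuous_comp; exact: lcmap_continuous. Qed.
Definition lcmapM (U V W : linTopType k) (g : lcmap V W) (f : lcmap U V) :
  lcmap U W := LCMap (@comp_cont _ _ _ g f).
End LinearMaps.

Section Completion.
Variables (k : fieldType) (V : linTopType k).

(* The projective limit of the V/P: the condition says that the transition map
   V/P -> V/Q, for P `<=` Q, sends the P-component to the Q-component. *)
Record compl := Compl {
  compl_fun :> forall P : open_submod V, vquot P;
  compl_compat : forall (P Q : open_submod V) (v : V), {subset P <= Q} ->
    compl_fun P = vproj P v -> compl_fun Q = vproj Q v
}.

Lemma complP (x y : compl) : (forall P, x P = y P) -> x = y.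
Proof.
case: x y => [x cx] [y cy] /= xy.
have e : x = y by exact: functional_extensionality_dep.
by subst y; rewrite (Prop_irrelevance cx cy).
Qed.

HB.instance Definition _ := gen_eqMixin compl.
HB.instance Definition _ := gen_choiceMixin compl.

Lemma c0 : forall (P Q : open_submod V) (v : V), {subset P <= Q} ->
  0 = vproj P v -> 0 = vproj Q v.
Proof. by move=> P Q v PQ /esym/vproj0/PQ/vproj0. Qed.
Definition compl0 := Compl c0.

Lemma compl_repr (x : compl) (P Q : open_submod V) :
  {subset P <= Q} -> x Q = vproj Q (vrepr (x P)).
Proof. by move=> PQ; apply: compl_compat PQ _; rewrite vreprK. Qed.

Lemma cN (x : compl) (P Q : open_submod V) (v : V) : {subset P <= Q} ->
  - x P = vproj P v -> - x Q = vproj Q v.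
Proof.
move=> PQ e; rewrite -[v]opprK raddfN; congr (- _).
by apply: compl_compat PQ _; rewrite raddfN/= -e opprK.
Qed.
Definition complN x := Compl (@cN x).

Lemma cD (x y : compl) (P Q : open_submod V) (v : V) : {subset P <= Q} ->
  x P + y P = vproj P v -> x Q + y Q = vproj Q v.
Proof.
move=> PQ; rewrite (compl_repr x PQ) (compl_repr y PQ) -raddfD.
rewrite -{1}[x P]vreprK -{1}[y P]vreprK -raddfD.
by move=> /vprojP/PQ/vprojP.
Qed.
Definition complD x y := Compl (@cD x y).

Lemma cZ (c : k) (x : compl) (P Q : open_submod V) (v : V) : {subset P <= Q} ->
  c *: x P = vproj P v -> c *: x Q = vproj Q v.
Proof.
move=> PQ; rewrite (compl_repr x PQ) -{1}[x P]vreprK -!linearZ/=.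
by move=> /vprojP/PQ/vprojP.
Qed.
Definition complZ c x := Compl (@cZ c x).

Lemma cDA : associative complD.
Proof. by move=> x y z; apply: complP => P /=; rewrite addrA. Qed.
Lemma cDC : commutative complD.
Proof. by move=> x y; apply: complP => P /=; rewrite addrC. Qed.
Lemma c0D : left_id compl0 complD.
Proof. by move=> x; apply: complP => P /=; rewrite add0r. Qed.
Lemma cND : left_inverse compl0 complN complD.
Proof. by move=> x; apply: complP => P /=; rewrite addNr. Qed.
HB.instance Definition _ := GRing.isZmodule.Build compl cDA cDC c0D cND.

Lemma cZA a b (x : compl) : complZ a (complZ b x) = complZ (a * b) x.
Proof. by apply: complP => P /=; rewrite scalerA. Qed.
Lemma cZ1 (x : compl) : complZ 1 x = x.
Proof. by apply: complP => P /=; rewrite scale1r. Qed.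
Lemma cZDr a (x y : compl) : complZ a (x + y) = complZ a x + complZ a y.
Proof. by apply: complP => P /=; rewrite scalerDr. Qed.
Lemma cZDl (x : compl) a b : complZ (a + b) x = complZ a x + complZ b x.
Proof. by apply: complP => P /=; rewrite scalerDl. Qed.
HB.instance Definition _ := GRing.Zmodule_isLmodule.Build k compl cZA cZ1 cZDr cZDl.

Definition compl_proj (P : open_submod V) (x : compl) : vquot P := x P.

Lemma ker_closed P : submod_closed (fun x => compl_proj P x == 0).
Proof.
split; first by rewrite unfold_in.
move=> c x y; rewrite !unfold_in => /eqP x0 /eqP y0.
by rewrite /compl_proj/= -/(compl_proj P x) -/(compl_proj P y) x0 y0 scaler0 addr0.
Qed.

Definition compl_ker (P : open_submod V) : submodClosed compl :=
  HB.pack_for (submodClosed compl) (fun x => compl_proj P x == 0)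
    (GRing.isSubmodClosed.Build k compl (fun x => compl_proj P x == 0)
       (ker_closed P)).

Lemma compl_kerP (P : open_submod V) x : (x \in compl_ker P) <-> x P = 0.
Proof. by split=> [/eqP|xP]; last exact/eqP. Qed.

Lemma compl_kerS (P Q : open_submod V) :
  {subset P <= Q} -> {subset compl_ker P <= compl_ker Q}.
Proof.
move=> PQ x /compl_kerP xP; apply/compl_kerP.
by rewrite (@compl_compat x P Q 0 PQ) ?raddf0.
Qed.

Lemma ker_ex : exists K, exists P : open_submod V, K = compl_ker P.
Proof. by have [P _] := open_submodT V; exists (compl_ker P), P. Qed.

Lemma kerI (K L : submodClosed compl) :
  (exists P, K = compl_ker P) -> (exists P, L = compl_ker P) ->
  exists R, [/\ (exists P, R = compl_ker P), {subset R <= K} & {subset R <= L}].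
Proof.
move=> [P ->] [Q ->]; have [R [RP RQ]] := open_submodI P Q.
by exists (compl_ker R); split; [exists R|exact: compl_kerS|exact: compl_kerS].
Qed.

HB.instance Definition _ := Lmodule_isLinTop.Build k compl ker_ex kerI.

Lemma open_compl_ker (P : open_submod V) : open [set` compl_ker P].
Proof.
apply: open_submod_nbhs; exists (compl_ker P); split; first by exists P.
by move=> v; rewrite add0r.
Qed.

Lemma open_complP (S : open_submod compl) :
  exists P : open_submod V, {subset compl_ker P <= S}.
Proof.
have : nbhs (0 : compl) [set` S].
  by apply: open_nbhs_nbhs; split; [exact: osubmod_open|exact: rpred0].
by move=> [_ [[P ->] KS]]; exists P => x /KS; rewrite add0r.
Qed.

Lemma to_compl_compat (x : V) (P Q : open_submod V) (v : V) :
  {subset P <= Q} -> vproj P x = vproj P v -> vproj Q x = vproj Q v.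
Proof. by move=> PQ /vprojP/PQ/vprojP. Qed.

Definition to_compl (x : V) : compl := Compl (@to_compl_compat x).

Definition lin_separated := injective to_compl.
Definition lin_complete := forall y : compl, exists x : V, to_compl x = y.

End Completion.

Section CompletionComplete.
Variables (k : fieldType) (V : linTopType k).

Local Notation oker P := (OpenSubmod (@open_compl_ker k V P)).

Lemma compl_separated : lin_separated (compl V).
Proof.
move=> x y xy; apply: complP => P.
have /vprojP/compl_kerP /= : vproj (oker P) x = vproj (oker P) y.
  exact: (congr1 (fun z : compl (compl V) => z (oker P)) xy).
by move=> /eqP; rewrite subr_eq0 => /eqP.
Qed.

Lemma compl_complete : lin_complete (compl V).
Proof.
move=> y.
pose f (P : open_submod V) : vquot P := vrepr (y (oker P)) P.
have fE (P : open_submod V) (z : compl V) :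
    y (oker P) = vproj (oker P) z -> f P = z P.
  rewrite -{1}[y (oker P)]vreprK => /vprojP/compl_kerP /= /eqP.
  by rewrite subr_eq0 => /eqP.
have fc (P Q : open_submod V) v : {subset P <= Q} ->
    f P = vproj P v -> f Q = vproj Q v.
  move=> PQ fPv; rewrite (fE Q (vrepr (y (oker P)))); last first.
    apply: (@compl_compat _ _ y (oker P)); last by rewrite vreprK.
    exact: compl_kerS.
  exact: (compl_compat PQ fPv).
exists (Compl fc); apply: complP => S.
have [P PS] := open_complP S.
apply/esym/(@compl_compat _ _ y (oker P)) => //.
rewrite -[LHS]vreprK; apply/vprojP/compl_kerP => /=.
by rewrite /f subrr.
Qed.
End CompletionComplete.

Section CompletionMap.
Variable k : fieldType.

Section Def.
Variables (V W : linTopType k) (f : lcmap V W).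

Definition compl_map_fun (x : compl V) (Q : open_submod W) : vquot Q :=
  vproj Q (f (vrepr (x (preim_open f Q)))).

Lemma compl_map_funE (x : compl V) (P : open_submod V) (Q : open_submod W) v :
  (forall u, u \in P -> f u \in Q) -> x P = vproj P v ->
  compl_map_fun x Q = vproj Q (f v).
Proof.
move=> PQ xPv; apply/vprojP; rewrite -linearB.
rewrite -[_ \in Q]/(_ \in preim_open f Q); apply/vprojP; rewrite vreprK.
by apply: compl_compat xPv => u uP; exact: PQ.
Qed.

Lemma compl_map_compat (x : compl V) (P Q : open_submod W) w : {subset P <= Q} ->
  compl_map_fun x P = vproj P w -> compl_map_fun x Q = vproj Q w.
Proof.
move=> PQ; rewrite (@compl_map_funE x (preim_open f P) Q (vrepr (x (preim_open f P)))).
- by move=> /vprojP/PQ/vprojP.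
- by move=> u uP; exact: PQ.
- by rewrite vreprK.
Qed.

Definition compl_map (x : compl V) : compl W := Compl (@compl_map_compat x).

Lemma compl_mapE (x : compl V) (P : open_submod V) (Q : open_submod W) v :
  (forall u, u \in P -> f u \in Q) -> x P = vproj P v ->
  compl_map x Q = vproj Q (f v).
Proof. exact: compl_map_funE. Qed.

Lemma compl_map_to_compl v : compl_map (to_compl v) = to_compl (f v).
Proof. by apply: complP => Q; exact: (@compl_mapE _ (preim_open f Q)). Qed.

Lemma compl_map_linear : linear compl_map.
Proof.
move=> c x y; apply: complP => Q.
rewrite (@compl_mapE _ (preim_open f Q) Q
  (c *: vrepr (x (preim_open f Q)) + vrepr (y (preim_open f Q)))) => //.
- by rewrite 2!linearP /=.
- by rewrite linearP /= !vreprK.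
Qed.
HB.instance Definition _ :=
  GRing.isLinear.Build k (compl V) (compl W) *:%R compl_map compl_map_linear.

Lemma compl_map_continuous : continuous compl_map.
Proof.
apply/linear_continuousP => S; have [Q QS] := open_complP S.
exists (OpenSubmod (@open_compl_ker _ _ (preim_open f Q))).
move=> x /compl_kerP xQ; apply/QS/compl_kerP.
by rewrite (@compl_mapE _ (preim_open f Q) Q 0) ?raddf0.
Qed.

Definition compl_lcmap : lcmap (compl V) (compl W) := LCMap compl_map_continuous.
End Def.

Lemma compl_lcmap1 (V : linTopType k) :
  compl_lcmap (lcmap1 V) = lcmap1 (compl V).
Proof.
apply: lcmapP => x; apply: complP => P.
by rewrite /= (@compl_map_funE _ _ _ _ P P (vrepr (x P))) ?vreprK.
Qed.

Lemma compl_lcmapM (U V W : linTopType k) (g : lcmap V W) (f : lcmap U V) :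
  compl_lcmap (lcmapM g f) = lcmapM (compl_lcmap g) (compl_lcmap f).
Proof.
apply: lcmapP => x; apply: complP => R.
pose P := preim_open f (preim_open g R).
rewrite /= (@compl_map_funE _ _ _ _ P R (vrepr (x P))) ?vreprK//.
by rewrite (@compl_map_funE _ _ _ _ (preim_open g R) R (f (vrepr (x P)))).
Qed.
End CompletionMap.

Section TopSC.
Variable k : fieldType.

Record topsc := TopscObj {
  topsc_space :> linTopType k;
  topsc_separated : lin_separated topsc_space;
  topsc_complete : lin_complete topsc_space
}.

Definition compl_topsc (V : linTopType k) : topsc :=
  TopscObj (@compl_separated k V) (@compl_complete k V).
End TopSC.

Section FreeModule.
Variables (k : fieldType) (K : choiceType).

Definition free_mod := {freeg K / k}.
HB.instance Definition _ := GRing.Lmodule.on free_mod.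

Definition free_gen (p : K) : free_mod := Freeg [:: (1, p)].

Section Lift.
Variables (W : lmodType k) (f : K -> W).

Definition free_lift (x : free_mod) : W := fglift f x.

Lemma free_liftB : zmod_morphism free_lift.
Proof. exact: (@lift_is_additive k K W f). Qed.
HB.instance Definition _ :=
  GRing.isZmodMorphism.Build free_mod W free_lift free_liftB.

Lemma free_lift_gen p : free_lift (free_gen p) = f p.
Proof. by rewrite /free_lift liftU scale1r. Qed.

Lemma free_lift_sum (s : seq K) (c : K -> k) :
  free_lift (\sum_(p <- s) Freeg [:: (c p, p)]) = \sum_(p <- s) c p *: f p.
Proof.
elim: s => [|p s IHs]; first by rewrite !big_nil raddf0.
rewrite !big_cons -IHs -[c p *: f p]liftU.
exact: (raddfD free_lift).
Qed.

Lemma free_liftZ : scalable free_lift.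
Proof.
move=> c x; rewrite -[LHS]/(free_lift (fgscale c x)) free_lift_sum.
have := free_lift_sum (dom x) (fun p => coeff p x); rewrite freeg_sumE => ->.
by rewrite scaler_sumr; apply: eq_bigr => p _; rewrite scalerA.
Qed.
HB.instance Definition _ :=
  GRing.isScalable.Build k free_mod W *:%R free_lift free_liftZ.
End Lift.

Lemma free_ind (S : submodClosed free_mod) :
  (forall p, free_gen p \in S) -> forall x, x \in S.
Proof.
move=> gS x; rewrite -[x]freeg_sumE.
elim: (dom x) => [|p s IHs]; first by rewrite big_nil; exact: rpred0.
rewrite big_cons.
have -> : Freeg [:: (coeff p x, p)] = coeff p x *: free_gen p.
  by apply/eqP/freeg_eqP => q; rewrite coeffZ !coeffU mul1r.
by apply: rpredD => //; exact: rpredZ.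
Qed.
End FreeModule.

Section Tensor.
Variable k : fieldType.

Section Def.
Variables U V : lmodType k.

Local Notation free := (free_mod k (U * V)%type).
Local Notation gen u v := (free_gen k (u, v)).

(* The free vector space on U * V modulo the subspace spanned by the
   bilinearity relations. *)
Definition bilin_rels (S : submodClosed free) :=
  (forall c u u' v,
     gen (c *: u + u') v - c *: gen u v - gen u' v \in S) /\
  (forall c u v v',
     gen u (c *: v + v') - c *: gen u v - gen u v' \in S).

Definition bilin_span : set free := [set x | forall S, bilin_rels S -> x \in S].

Lemma span0 : bilin_span 0.
Proof. by move=> S _; rewrite rpred0. Qed.
Lemma spanL c x y : bilin_span x -> bilin_span y -> bilin_span (c *: x + y).
Proof. by move=> xS yS S rS; apply: submod_lin; [exact: xS|exact: yS]. Qed.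

Definition bilin_submod := mk_submod span0 spanL.

Definition tensor := vquot bilin_submod.
HB.instance Definition _ := GRing.Lmodule.on tensor.

Definition tens (u : U) (v : V) : tensor := vproj bilin_submod (gen u v).

Lemma tens_linl c u u' v : tens (c *: u + u') v = c *: tens u v + tens u' v.
Proof.
rewrite /tens -linearP; apply/vprojP; apply/mem_mk_submod => S [rS _].
by rewrite opprD addrA; exact: rS.
Qed.

Lemma tens_linr c u v v' : tens u (c *: v + v') = c *: tens u v + tens u v'.
Proof.
rewrite /tens -linearP; apply/vprojP; apply/mem_mk_submod => S [_ rS].
by rewrite opprD addrA; exact: rS.
Qed.

Lemma tensor_ind (S : submodClosed tensor) :
  (forall u v, tens u v \in S) -> forall x, x \in S.
Proof.
move=> tS x; rewrite -[x]vreprK.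
set A := [set y : free | vproj bilin_submod y \in S].
have A0 : A 0 by rewrite /A/= raddf0 rpred0.
have AL c y z : A y -> A z -> A (c *: y + z).
  by rewrite /A/= linearP => Ay Az; exact: submod_lin.
suff : vrepr x \in mk_submod A0 AL by move/mem_mk_submod.
by apply: free_ind => -[u v]; apply/mem_mk_submod; exact: tS.
Qed.
End Def.

Section Lift.
Variables (U V W : lmodType k) (b : U -> V -> W).

Definition bilinear_map :=
  (forall c u u' v, b (c *: u + u') v = c *: b u v + b u' v) /\
  (forall c u v v', b u (c *: v + v') = c *: b u v + b u v').

Definition tens_lift (x : tensor U V) : W :=
  free_lift (fun p : U * V => b p.1 p.2) (vrepr x).

Hypothesis bil : bilinear_map.

Local Notation lift := (free_lift (fun p : U * V => b p.1 p.2)).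

Lemma tens_liftE x : tens_lift (vproj (bilin_submod U V) x) = lift x.
Proof.
apply/eqP; rewrite -subr_eq0 -raddfB; apply/eqP.
set A := [set y | lift y = 0].
have A0 : A 0 by exact: (raddf0 (free_lift _)).
have AL c y z : A y -> A z -> A (c *: y + z).
  move=> y0 z0; rewrite /A/= linearP/= -[X in _ *: X]/(lift y).
  by rewrite -[X in _ + X]/(lift z) (y0 : lift y = 0) (z0 : lift z = 0) scaler0 addr0.
have : vrepr (vproj (bilin_submod U V) x) - x \in bilin_submod U V.
  by apply/vprojP; rewrite vreprK.
move=> /mem_mk_submod/(_ (mk_submod A0 AL)) H; apply/(mem_mk_submod A0 AL)/H.
have [bl br] := bil; split=> [c u u' v|c u v v']; apply/mem_mk_submod.
  by rewrite /A/= !raddfB/= linearZ/= !free_lift_gen/= bl addrAC addrK subrr.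
by rewrite /A/= !raddfB/= linearZ/= !free_lift_gen/= br addrAC addrK subrr.
Qed.

Lemma tens_lift_tens u v : tens_lift (tens u v) = b u v.
Proof. by rewrite tens_liftE; exact: free_lift_gen. Qed.

Lemma tens_lift_linear : linear tens_lift.
Proof.
move=> c x y; have [x' ->] := vproj_surj x; have [y' ->] := vproj_surj y.
rewrite -linearP !tens_liftE; exact: (linearP (free_lift _)).
Qed.
End Lift.

Lemma tensor_ext (U V W : lmodType k) (f g : {linear tensor U V -> W}) :
  (forall u v, f (tens u v) = g (tens u v)) -> f =1 g.
Proof.
move=> fg x; set A := [set y : tensor U V | f y = g y].
have A0 : A 0 by rewrite /A/= !raddf0.
have AL c y z : A y -> A z -> A (c *: y + z).
  by rewrite /A/= !linearP => -> ->.
suff : x \in mk_submod A0 AL by move/mem_mk_submod.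
by apply: tensor_ind => u v; apply/mem_mk_submod/fg.
Qed.

Section Map.
Variables (U V U' V' : lmodType k) (f : {linear U -> U'}) (g : {linear V -> V'}).

Definition tens_map : tensor U V -> tensor U' V' :=
  tens_lift (fun u v => tens (f u) (g v)).

Lemma tens_map_bil : bilinear_map (fun u v => tens (f u) (g v)).
Proof.
by split=> [c u u' v|c u v v']; rewrite linearP ?tens_linl ?tens_linr.
Qed.

Lemma tens_mapE u v : tens_map (tens u v) = tens (f u) (g v).
Proof. exact: (tens_lift_tens tens_map_bil). Qed.

Lemma tens_map_lin : linear tens_map.
Proof. exact: (tens_lift_linear tens_map_bil). Qed.
HB.instance Definition _ :=
  GRing.isLinear.Build k (tensor U V) (tensor U' V') *:%R tens_map tens_map_lin.
End Map.
End Tensor.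

(* The indices of the topologies on the tensor product written *, <- and !. *)
Variant tensor_kind := Star | Arrow | Bang.

Section TensorTopology.
Variable k : fieldType.

(* U (x) V, tagged with the topology it is going to carry. *)
Definition tens_top (t : tensor_kind) (U V : linTopType k) : Type := tensor U V.
HB.instance Definition _ t U V := GRing.Lmodule.on (tens_top t U V).

Section Def.
Variables (t : tensor_kind) (U V : linTopType k).
Local Notation tens_top := (tens_top t U V).

(* For subspaces A, B, the inclusion A (x) B `<=` E into a subspace E is tested on
   the pure tensors, which span A (x) B. *)
Definition tens_open (E : submodClosed (tensor U V)) : Prop :=
  match t with
  | Star =>
    [/\ exists (P : open_submod U) (Q : open_submod V),
          forall u v, u \in P -> v \in Q -> tens u v \in E,
        forall u, exists Q : open_submod V, forall v, v \in Q -> tens u v \in E &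
        forall v, exists P : open_submod U, forall u, u \in P -> tens u v \in E]
  | Arrow =>
    (exists P : open_submod U, forall u v, u \in P -> tens u v \in E) /\
    (forall u, exists Q : open_submod V, forall v, v \in Q -> tens u v \in E)
  | Bang =>
    exists (P : open_submod U) (Q : open_submod V),
      (forall u v, u \in P -> tens u v \in E) /\
      (forall u v, v \in Q -> tens u v \in E)
  end.

Lemma tens_openS (E F : submodClosed (tensor U V)) :
  {subset E <= F} -> tens_open E -> tens_open F.
Proof.
rewrite /tens_open => EF; case: t.
- move=> [[P [Q PQ]] lE rE]; split.
  + by exists P, Q => u v uP vQ; apply/EF/PQ.
  + by move=> u; have [Q' H] := lE u; exists Q' => v /H/EF.
  + by move=> v; have [Q' H] := rE v; exists Q' => u /H/EF.
- move=> [[P PE] lE]; split; first by exists P => u v /(PE _ v)/EF.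
  by move=> u; have [Q' H] := lE u; exists Q' => v /H/EF.
- move=> [P [Q [PE QE]]]; exists P, Q.
  by split=> u v => [/(PE _ v)/EF|/(QE u)/EF].
Qed.

Lemma tens_openI (E F G : submodClosed (tensor U V)) :
  (forall x, x \in E -> x \in F -> x \in G) ->
  tens_open E -> tens_open F -> tens_open G.
Proof.
rewrite /tens_open => EFG; case: t.
- move=> [[P [Q PQ]] lE rE] [[P' [Q' PQ']] lF rF]; split.
  + have [R [RP RP']] := open_submodI P P'.
    have [T [TQ TQ']] := open_submodI Q Q'.
    exists R, T => u v uR vT.
    by apply: EFG; [apply/PQ/TQ/vT/RP|apply/PQ'/TQ'/vT/RP'].
  + move=> u; have [A HA] := lE u; have [B HB] := lF u.
    have [R [RA RB]] := open_submodI A B.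
    by exists R => v vR; apply: EFG; [apply/HA/RA|apply/HB/RB].
  + move=> u; have [A HA] := rE u; have [B HB] := rF u.
    have [R [RA RB]] := open_submodI A B.
    by exists R => v vR; apply: EFG; [apply/HA/RA|apply/HB/RB].
- move=> [[P PE] lE] [[P' PF] lF]; split.
    have [R [RP RP']] := open_submodI P P'.
    by exists R => u v uR; apply: EFG; [apply/PE/RP|apply/PF/RP'].
  move=> u; have [A HA] := lE u; have [B HB] := lF u.
  have [R [RA RB]] := open_submodI A B.
  by exists R => v vR; apply: EFG; [apply/HA/RA|apply/HB/RB].
- move=> [P [Q [PE QE]]] [P' [Q' [PF QF]]].
  have [R [RP RP']] := open_submodI P P'.
  have [T [TQ TQ']] := open_submodI Q Q'.
  exists R, T; split=> u v => [uR|vT]; apply: EFG.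
  + exact/PE/RP.
  + exact/PF/RP'.
  + exact/QE/TQ.
  + exact/QF/TQ'.
Qed.

Lemma full_T : [set: tensor U V] 0. Proof. by []. Qed.
Lemma full_L c (x y : tensor U V) : [set: tensor U V] x -> [set: tensor U V] y ->
  [set: tensor U V] (c *: x + y).
Proof. by []. Qed.

Lemma tens_open_ex : exists E : submodClosed tens_top, tens_open E.
Proof.
have [P _] := open_submodT U; have [Q _] := open_submodT V.
have xE x : x \in mk_submod full_T full_L by apply/mem_mk_submod.
exists (mk_submod full_T full_L); rewrite /tens_open; case: t.
- by split; [exists P, Q|move=> u; exists Q|move=> v; exists P].
- by split; [exists P|move=> u; exists Q].
- by exists P, Q.
Qed.

Lemma tens_openR (E F : submodClosed tens_top) : tens_open E -> tens_open F ->
  exists G : submodClosed tens_top,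
    [/\ tens_open G, {subset G <= E} & {subset G <= F}].
Proof.
move=> oE oF; set A := [set x | x \in E /\ x \in F].
have A0 : A 0 by split; exact: rpred0.
have AL c x y : A x -> A y -> A (c *: x + y).
  by move=> [xE xF] [yE yF]; split; exact: submod_lin.
exists (mk_submod A0 AL); split.
- by apply: tens_openI oE oF => x xE xF; apply/mem_mk_submod.
- by move=> x /mem_mk_submod[].
- by move=> x /mem_mk_submod[].
Qed.

HB.instance Definition _ :=
  Lmodule_isLinTop.Build k tens_top tens_open_ex tens_openR.

Lemma open_tensP (E : submodClosed tens_top) : open [set` E] <-> tens_open E.
Proof.
split=> [oE|oE]; last first.
  by apply: open_submod_nbhs; exists E; split=> // v; rewrite add0r.
have : nbhs (0 : tens_top) [set` E].
  by apply: open_nbhs_nbhs; split=> //; exact: rpred0.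
move=> [F [oF FE]]; apply: tens_openS oF => x /FE.
by rewrite add0r.
Qed.
End Def.

Section Map.
Variables (t : tensor_kind) (U V U' V' : linTopType k).
Variables (f : lcmap U U') (g : lcmap V V').

Lemma tens_open_preim (E : submodClosed (tensor U' V'))
    (F : submodClosed (tensor U V)) :
  (forall u v, tens (f u) (g v) \in E -> tens u v \in F) ->
  tens_open t E -> tens_open t F.
Proof.
move=> EF; rewrite /tens_open; case: t.
- move=> [[P [Q PQ]] lE rE]; split.
  + exists (preim_open f P), (preim_open g Q) => u v uP vQ.
    by apply: EF; exact: PQ.
  + move=> u; have [Q' H] := lE (f u); exists (preim_open g Q') => v vQ.
    by apply: EF; exact: H.
  + move=> v; have [P' H] := rE (g v); exists (preim_open f P') => u uP.
    by apply: EF; exact: H.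
- move=> [[P PE] lE]; split.
    by exists (preim_open f P) => u v uP; apply: EF; exact: PE.
  move=> u; have [Q' H] := lE (f u); exists (preim_open g Q') => v vQ.
  by apply: EF; exact: H.
- move=> [P [Q [PE QE]]]; exists (preim_open f P), (preim_open g Q).
  by split=> u v H; apply: EF; [exact: PE|exact: QE].
Qed.

Definition tens_top_map : tens_top t U V -> tens_top t U' V' := tens_map f g.
HB.instance Definition _ := GRing.Linear.on tens_top_map.

Lemma tens_top_map_continuous : continuous tens_top_map.
Proof.
apply/linear_continuousP => E.
suff /open_tensP oP : tens_open t (preim_submod tens_top_map E).
  by exists (OpenSubmod oP).
have /open_tensP := osubmod_open E; apply: tens_open_preim => u v H.
have e := tens_mapE f g u v; rewrite -e in H.
by rewrite (mem_preim_submod tens_top_map); exact: H.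
Qed.

Definition tens_lcmap : lcmap (tens_top t U V) (tens_top t U' V') :=
  LCMap tens_top_map_continuous.
End Map.

Lemma tens_lcmap1 t (U V : linTopType k) :
  tens_lcmap t (lcmap1 U) (lcmap1 V) = lcmap1 (tens_top t U V).
Proof.
by apply: lcmapP; apply: tensor_ext => u v; exact: tens_mapE.
Qed.

Lemma tens_lcmapM t (U U' U'' V V' V'' : linTopType k)
    (f' : lcmap U' U'') (f : lcmap U U') (g' : lcmap V' V'') (g : lcmap V V') :
  tens_lcmap t (lcmapM f' f) (lcmapM g' g) =
  lcmapM (tens_lcmap t f' g') (tens_lcmap t f g).
Proof.
apply: lcmapP; apply: (@tensor_ext _ _ _ _
  (lcmap_lin (tens_lcmap t (lcmapM f' f) (lcmapM g' g)))
  (lcmap_lin (lcmapM (tens_lcmap t f' g') (tens_lcmap t f g)))) => u v.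
by rewrite /= /tens_top_map !tens_mapE.
Qed.
End TensorTopology.

Section ZeroSpace.
Variable k : fieldType.

Definition zero_space := 'rV[k]_0.
HB.instance Definition _ := GRing.Lmodule.on zero_space.

Lemma zero_base_ex : exists P : submodClosed zero_space, True.
Proof.
have A0 : [set: zero_space] 0 by [].
have AL c (x y : zero_space) : [set: zero_space] x -> [set: zero_space] y ->
  [set: zero_space] (c *: x + y) by [].
by exists (mk_submod A0 AL).
Qed.

Lemma zero_baseI (P Q : submodClosed zero_space) : True -> True ->
  exists R : submodClosed zero_space,
    [/\ True, {subset R <= P} & {subset R <= Q}].
Proof.
by move=> _ _; exists P; split=> // x _; rewrite (thinmx0 x) rpred0.
Qed.
HB.instance Definition _ := Lmodule_isLinTop.Build k zero_space zero_base_ex zero_baseI.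

Lemma compl_zero_space : lcmap1 (compl_topsc zero_space) = 0.
Proof.
apply: lcmapP => x; apply: complP => P /=.
by rewrite -[x P]vreprK (thinmx0 (vrepr (x P))) raddf0.
Qed.
End ZeroSpace.

Section DirectSum.
Variables (k : fieldType) (A B : linTopType k).

Definition dsum := (A * B)%type.
HB.instance Definition _ := GRing.Lmodule.on dsum.

Definition box (P : open_submod A) (Q : open_submod B) : set dsum :=
  [set x | x.1 \in P /\ x.2 \in Q].

Lemma box0 P Q : box P Q 0.
Proof. by split; exact: rpred0. Qed.
Lemma boxL P Q c x y : box P Q x -> box P Q y -> box P Q (c *: x + y).
Proof. by move=> [xP xQ] [yP yQ]; split; exact: submod_lin. Qed.
Definition box_submod P Q : submodClosed dsum := mk_submod (@box0 P Q) (@boxL P Q).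

Definition dsum_base (S : submodClosed dsum) := exists P Q, S = box_submod P Q.

Lemma dsum_base_ex : exists S, dsum_base S.
Proof.
have [P _] := open_submodT A; have [Q _] := open_submodT B.
by exists (box_submod P Q), P, Q.
Qed.

Lemma dsum_baseI (S T : submodClosed dsum) : dsum_base S -> dsum_base T ->
  exists R, [/\ dsum_base R, {subset R <= S} & {subset R <= T}].
Proof.
move=> [P [Q ->]] [P' [Q' ->]].
have [R [RP RP']] := open_submodI P P'; have [T' [TQ TQ']] := open_submodI Q Q'.
exists (box_submod R T'); split; first by exists R, T'.
  by move=> x /mem_mk_submod[x1 x2]; apply/mem_mk_submod; split; [exact: RP|exact: TQ].
by move=> x /mem_mk_submod[x1 x2]; apply/mem_mk_submod; split; [exact: RP'|exact: TQ'].
Qed.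
HB.instance Definition _ := Lmodule_isLinTop.Build k dsum dsum_base_ex dsum_baseI.

Lemma open_box P Q : open [set` box_submod P Q].
Proof.
apply: open_submod_nbhs; exists (box_submod P Q); split; first by exists P, Q.
by move=> v; rewrite add0r.
Qed.
Definition obox P Q := OpenSubmod (@open_box P Q).

Lemma open_boxP (S : open_submod dsum) :
  exists P Q, {subset obox P Q <= S}.
Proof.
have : nbhs (0 : dsum) [set` S].
  by apply: open_nbhs_nbhs; split; [exact: osubmod_open|exact: rpred0].
by move=> [_ [[P [Q ->]] S0]]; exists P, Q => x /S0; rewrite add0r.
Qed.

Definition dfst (x : dsum) : A := x.1.
Definition dsnd (x : dsum) : B := x.2.
Definition dinl (a : A) : dsum := (a, 0).
Definition dinr (b : B) : dsum := (0, b).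

Lemma dfst_lin : linear dfst. Proof. by []. Qed.
HB.instance Definition _ := GRing.isLinear.Build k dsum A *:%R dfst dfst_lin.
Lemma dsnd_lin : linear dsnd. Proof. by []. Qed.
HB.instance Definition _ := GRing.isLinear.Build k dsum B *:%R dsnd dsnd_lin.
Lemma dinl_lin : linear dinl.
Proof.
move=> c x y; rewrite -[RHS]/(c *: x + y, c *: (0 : B) + 0).
by rewrite scaler0 addr0.
Qed.
HB.instance Definition _ := GRing.isLinear.Build k A dsum *:%R dinl dinl_lin.
Lemma dinr_lin : linear dinr.
Proof.
move=> c x y; rewrite -[RHS]/(c *: (0 : A) + 0, c *: x + y).
by rewrite scaler0 addr0.
Qed.
HB.instance Definition _ := GRing.isLinear.Build k B dsum *:%R dinr dinr_lin.

Lemma dfst_cont : continuous dfst.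
Proof.
apply/linear_continuousP => P; have [Q _] := open_submodT B.
by exists (obox P Q) => x /mem_mk_submod[].
Qed.
Lemma dsnd_cont : continuous dsnd.
Proof.
apply/linear_continuousP => Q; have [P _] := open_submodT A.
by exists (obox P Q) => x /mem_mk_submod[].
Qed.
Lemma dinl_cont : continuous dinl.
Proof.
apply/linear_continuousP => S; have [P [Q PQ]] := open_boxP S.
by exists P => x xP; apply/PQ/mem_mk_submod; split=> //; exact: rpred0.
Qed.
Lemma dinr_cont : continuous dinr.
Proof.
apply/linear_continuousP => S; have [P [Q PQ]] := open_boxP S.
by exists Q => x xP; apply/PQ/mem_mk_submod; split=> //; exact: rpred0.
Qed.
Definition lfst := LCMap dfst_cont.
Definition lsnd := LCMap dsnd_cont.
Definition linl := LCMap dinl_cont.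
Definition linr := LCMap dinr_cont.

Lemma dsum_separated : lin_separated A -> lin_separated B -> lin_separated dsum.
Proof.
move=> sA sB [a b] [a' b'] e.
have e1 : to_compl a = to_compl a'.
  by rewrite -[a]/(lfst (a, b)) -[a']/(lfst (a', b')) -!compl_map_to_compl e.
have e2 : to_compl b = to_compl b'.
  by rewrite -[b]/(lsnd (a, b)) -[b']/(lsnd (a', b')) -!compl_map_to_compl e.
by rewrite (sA _ _ e1) (sB _ _ e2).
Qed.

Lemma dsum_complete : lin_complete A -> lin_complete B -> lin_complete dsum.
Proof.
move=> cA cB y; have [a ea] := cA (compl_map lfst y).
have [b eb] := cB (compl_map lsnd y).
exists (a, b); apply: complP => S; have [P [Q PQ]] := open_boxP S.
apply/esym/(compl_compat PQ); rewrite -[LHS]vreprK; apply/vprojP.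
have ySE := esym (vreprK (y (obox P Q))).
have eP : vproj P a = vproj P (vrepr (y (obox P Q))).1.
  rewrite -[LHS]/(to_compl a P) ea; apply: (compl_mapE _ ySE).
  by move=> u /mem_mk_submod[].
have eQ : vproj Q b = vproj Q (vrepr (y (obox P Q))).2.
  rewrite -[LHS]/(to_compl b Q) eb; apply: (compl_mapE _ ySE).
  by move=> u /mem_mk_submod[].
apply/mem_mk_submod; split.
  by apply/vprojP/esym.
by apply/vprojP/esym.
Qed.
End DirectSum.

Section TopSC.
Variable k : fieldType.

Definition dsum_topsc (A B : topsc k) : topsc k :=
  TopscObj (dsum_separated (@topsc_separated _ A) (@topsc_separated _ B))
            (dsum_complete (@topsc_complete _ A) (@topsc_complete _ B)).

Lemma tcompA (A B C D : topsc k) (h : lcmap C D) (g : lcmap B C) (f : lcmap A B) :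
  lcmapM h (lcmapM g f) = lcmapM (lcmapM h g) f.
Proof. exact: lcmapP. Qed.
Lemma tcomp1m (A B : topsc k) (f : lcmap A B) : lcmapM (lcmap1 B) f = f.
Proof. exact: lcmapP. Qed.
Lemma tcompm1 (A B : topsc k) (f : lcmap A B) : lcmapM f (lcmap1 A) = f.
Proof. exact: lcmapP. Qed.
Lemma tcompDl (A B C : topsc k) (g g' : lcmap B C) (f : lcmap A B) :
  lcmapM (g + g') f = lcmapM g f + lcmapM g' f.
Proof. exact: lcmapP. Qed.
Lemma tcompDr (A B C : topsc k) (g : lcmap B C) (f f' : lcmap A B) :
  lcmapM g (f + f') = lcmapM g f + lcmapM g f'.
Proof. by apply: lcmapP => x /=; exact: (raddfD (lcmap_lin g)). Qed.
Lemma tzero : exists Z : topsc k, lcmap1 Z = 0.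
Proof. by exists (compl_topsc (zero_space k)); exact: compl_zero_space. Qed.
Lemma tbiprod (A B : topsc k) : exists (P : topsc k)
    (iA : lcmap A P) (iB : lcmap B P) (pA : lcmap P A) (pB : lcmap P B),
  [/\ lcmapM pA iA = lcmap1 A, lcmapM pB iB = lcmap1 B, lcmapM pA iB = 0,
      lcmapM pB iA = 0 & lcmapM iA pA + lcmapM iB pB = lcmap1 P].
Proof.
exists (dsum_topsc A B), (linl A B), (linr A B), (lfst A B), (lsnd A B).
split.
- exact: lcmapP.
- exact: lcmapP.
- exact: lcmapP.
- exact: lcmapP.
- apply: lcmapP => -[a b].
  by apply/eqP; rewrite -pair_eqE /= addr0 add0r !eqxx.
Qed.

Definition TopSC : additive_category :=
  @AdditiveCategory (topsc k) (fun A B => lcmap A B) (fun A => lcmap1 A)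
    (fun A B C g f => lcmapM g f)
    tcompA tcomp1m tcompm1 tcompDl tcompDr tzero tbiprod.

Definition ctens (t : tensor_kind) (U V : TopSC) : TopSC :=
  compl_topsc (tens_top t U V).

Definition ctens_map (t : tensor_kind) (U U' V V' : TopSC)
    (f : hom U U') (g : hom V V') : hom (ctens t U V) (ctens t U' V') :=
  compl_lcmap (tens_lcmap t f g).

Lemma ctens_map1 t (U V : TopSC) :
  ctens_map t (idm U) (idm V) = idm (ctens t U V).
Proof. by rewrite /ctens_map tens_lcmap1 compl_lcmap1. Qed.

Lemma ctens_mapM t (U U' U'' V V' V'' : TopSC) (f' : hom U' U'') (f : hom U U')
    (g' : hom V' V'') (g : hom V V') :
  ctens_map t (f' \oc f) (g' \oc g) = ctens_map t f' g' \oc ctens_map t f g.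
Proof. by rewrite /ctens_map tens_lcmapM compl_lcmapM. Qed.

Lemma ctensrM t (U A B D : TopSC) (g : hom B D) (f : hom A B) :
  ctens_map t (idm U) (g \oc f) =
  ctens_map t (idm U) g \oc ctens_map t (idm U) f.
Proof. by rewrite -ctens_mapM comp1m. Qed.

Lemma ctenslM t (U A B D : TopSC) (g : hom B D) (f : hom A B) :
  ctens_map t (g \oc f) (idm U) =
  ctens_map t g (idm U) \oc ctens_map t f (idm U).
Proof. by rewrite -ctens_mapM comp1m. Qed.

(* ctensr t U is the functor U (x) - and ctensl t U is - (x) U. *)
Definition ctensr (t : tensor_kind) (U : TopSC) : endofunctor TopSC :=
  Endofunctor (fobj := fun V => ctens t U V)
    (fmap := fun A B g => ctens_map t (idm U) g)
    (fun V => ctens_map1 t U V) (@ctensrM t U).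

Definition ctensl (t : tensor_kind) (U : TopSC) : endofunctor TopSC :=
  Endofunctor (fobj := fun V => ctens t V U)
    (fmap := fun A B g => ctens_map t g (idm U))
    (fun V => ctens_map1 t V U) (@ctenslM t U).

Definition bifunctor_exact (t : tensor_kind) (E : seq_class TopSC) :=
  forall U : TopSC, exact_functor E (ctensr t U) /\ exact_functor E (ctensl t U).
End TopSC.

(* Main.v *)
From Pilot Require Import Defs.
From HB Require Import structures.
From mathcomp Require Import all_boot all_algebra.
From mathcomp Require Import all_classical topology.

(** The category of complete separated spaces has an explicit largest exact
    structure: its sequences A -> B -> D are those in which A is embedded with
    the induced topology, D is the cokernel, and B -> D is surjective
    ([strict_ses]).  Indeed an admissible epimorphism can be pulled back along
    the map from a discrete line to any point of D, which forces surjectivity,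
    and the two other conditions say that it is a cokernel and that A is
    embedded as its kernel ([exact_structure_strict]).

    Among the strict sequences, consider those that stay strict under all
    iterated applications of the six families of functors obtained by fixing
    one argument of the three tensor products.  Every exact structure for
    which these functors are exact consists of such sequences, so it is enough
    to show that these sequences form an exact structure
    ([stable_strict_exact]); it is then the largest one of the required kind,
    and a largest element is the unique maximal one.

    The point is that the functors preserve cokernels ([ctensr_coker],
    [ctensl_coker]).  A cokernel in this category is the completion of a
    quotient, and the three kinds of continuous bilinear maps to a discrete
    space extend to completions and descend to quotients in either argument
    ([bilinear_extension], [tens_strict_r], [tens_strict_l]).  Therefore the
    functors preserve pushouts, and each axiom reduces to a statement that a
    sequence is strict because it fits into a diagram made of strict sequences,
    commutation relations and cokernels, all of which the functors preserve.
    Three such statements carry the proof: pushouts of strict sequences are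
    complete before any completion ([pushout_surjective]), the obscure axiom,
    which handles pullbacks ([strict_ses_obscure]), and a five lemma, which
    handles composites of epimorphisms ([strict_ses_epi_comp]). *)

Set Implicit Arguments.
Unset Strict Implicit.
Unset Printing Implicit Defensive.

Import GRing.Theory.
Import Pilot.Defs.
Local Open Scope ring_scope.

(** * Limits and extension by continuity *)

Section LcmapMorphism.
Variables (k : fieldType) (V W : linTopType k) (f : lcmap V W).

Lemma lcm0 : f 0 = 0. Proof. exact: raddf0. Qed.
Lemma lcmN x : f (- x) = - f x. Proof. exact: raddfN. Qed.
Lemma lcmB x y : f (x - y) = f x - f y. Proof. exact: raddfB. Qed.
Lemma lcmD x y : f (x + y) = f x + f y. Proof. exact: raddfD. Qed.
Lemma lcmZ a x : f (a *: x) = a *: f x. Proof. exact: linearZ. Qed.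
End LcmapMorphism.

Section ToCompletion.
Variables (k : fieldType) (V : linTopType k).

Lemma to_compl_linear : linear (@to_compl k V).
Proof. by move=> c x y; apply: complP => P /=; exact: (linearP (vproj P)). Qed.
HB.instance Definition _ :=
  GRing.isLinear.Build k V (compl V) *:%R (@to_compl k V) to_compl_linear.

Lemma to_compl_continuous : continuous (@to_compl k V).
Proof.
apply/linear_continuousP => S; have [P PS] := open_complP S.
by exists P => x xP; apply/PS/compl_kerP/vproj0.
Qed.
Definition to_compl_lcmap : lcmap V (compl V) := LCMap to_compl_continuous.

Lemma to_compl_dense (y : compl V) (S : open_submod (compl V)) :
  exists x, to_compl x - y \in S.
Proof.
have [P PS] := open_complP S; exists (vrepr (y P)).
by apply/PS/compl_kerP; rewrite /= vreprK subrr.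
Qed.
End ToCompletion.

Section Limits.
Variable k : fieldType.
Implicit Types A B D X Y : topsc k.

(** The topology on B pulled back from Y along c is fine enough to make g
    continuous. *)
Definition induced_by B Y X (c : lcmap B Y) (g : lcmap B X) :=
  forall S : open_submod X, exists R : open_submod Y,
    forall b, c b \in R -> g b \in S.

Definition embedding B Y (c : lcmap B Y) := induced_by c (lcmap1 B).

Definition adherent B Y (c : lcmap B Y) (y : Y) :=
  forall R : open_submod Y, exists b, c b - y \in R.

Definition dense_image B Y (c : lcmap B Y) := forall y, adherent c y.

Lemma submodN (V : lmodType k) (P : submodClosed V) v : v \in P -> - v \in P.
Proof. by move=> vP; rewrite -sub0r; apply: submodB => //; exact: rpred0. Qed.

Lemma submod_subC (V : lmodType k) (P : submodClosed V) u v :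
  u - v \in P -> v - u \in P.
Proof. by move=> /submodN; rewrite opprB. Qed.

Lemma submod_trans (V : lmodType k) (P : submodClosed V) u v w :
  u - v \in P -> v - w \in P -> u - w \in P.
Proof. by move=> uv /(rpredD uv); rewrite addrA subrK. Qed.

Lemma submod_cong (V : lmodType k) (P : submodClosed V) u v :
  u - v \in P -> v \in P -> u \in P.
Proof. by move=> uv /(rpredD uv); rewrite subrK. Qed.

Lemma topsc_eq0 X (x : X) : (forall R : open_submod X, x \in R) -> x = 0.
Proof.
move=> xR; apply: (@topsc_separated _ X); apply: complP => P /=.
by apply/vprojP; rewrite subr0.
Qed.

Lemma topsc_eq X (x y : X) : (forall R : open_submod X, x - y \in R) -> x = y.
Proof. by move=> /topsc_eq0/subr0_eq. Qed.

(** Completeness as convergence of Cauchy nets indexed by the open subspaces: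
    such a net is a compatible family of classes in the discrete quotients. *)
Lemma topsc_limit X (xs : open_submod X -> X) :
  (forall P Q : open_submod X, {subset P <= Q} -> xs P - xs Q \in Q) ->
  exists x, forall P, x - xs P \in P.
Proof.
move=> xsC.
have C (P Q : open_submod X) v : {subset P <= Q} ->
    vproj P (xs P) = vproj P v -> vproj Q (xs Q) = vproj Q v.
  move=> PQ /vprojP/PQ Pv; apply/vprojP/(submod_trans _ Pv).
  exact/submod_subC/xsC.
have [x e] := @topsc_complete _ X (Compl C).
by exists x => P; apply/vprojP; exact: (congr1 (fun z : compl X => z P) e).
Qed.

Definition limit_at B Y X (c : lcmap B Y) (g : lcmap B X) (y : Y) (x : X) :=
  forall S : open_submod X, exists R : open_submod Y,
    forall b, c b - y \in R -> g b - x \in S.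

(** The values of g near y along c form a Cauchy net, because the topology
    that c induces on B makes g continuous. *)
Lemma limit_atP B Y X (c : lcmap B Y) (g : lcmap B X) y :
  adherent c y -> induced_by c g -> exists x, limit_at c g y x.
Proof.
move=> cy gc; have /choice[R HR] := gc.
have /choice[b Hb] : forall S, exists b, c b - y \in R S by move=> S; exact: cy.
have near S b' : c b' - y \in R S -> g b' - g (b S) \in S.
  move=> b'y; rewrite -raddfB; apply: HR; rewrite raddfB.
  exact: submod_trans b'y (submod_subC (Hb S)).
have [|x Hx] := @topsc_limit X (fun S => g (b S)).
  move=> P Q PQ; have [T [TP TQ]] := open_submodI (R P) (R Q).
  have [b' b'T] := cy T.
  apply: submod_trans (near Q b' (TQ _ b'T)).
  exact/PQ/submod_subC/near/TP.
exists x => S; exists (R S) => b' /near H.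
exact: submod_trans H (submod_subC (Hx S)).
Qed.

Lemma limit_at_uniq B Y X (c : lcmap B Y) (g : lcmap B X) y x x' :
  adherent c y -> limit_at c g y x -> limit_at c g y x' -> x = x'.
Proof.
move=> cy lx lx'; apply: topsc_eq => S.
have [R HR] := lx S; have [R' HR'] := lx' S.
have [T [TR TR']] := open_submodI R R'; have [b bT] := cy T.
exact: submod_trans (submod_subC (HR _ (TR _ bT))) (HR' _ (TR' _ bT)).
Qed.

Lemma limit_at_image B Y X (c : lcmap B Y) (g : lcmap B X) b :
  induced_by c g -> limit_at c g (c b) (g b).
Proof.
move=> gc S; have [R HR] := gc S; exists R => b'.
by rewrite -!raddfB; exact: HR.
Qed.

Lemma sub_lincomb (V : lmodType k) a (u v y y' : V) :
  u - (a *: y + y') = (u - a *: v - y') + a *: (v - y).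
Proof. by rewrite scalerBr addrA [u - _ - y']addrAC subrK opprD addrA addrAC. Qed.

Lemma limit_at_lin B Y X (c : lcmap B Y) (g : lcmap B X) a y y' x x' :
  limit_at c g y x -> limit_at c g y' x' -> adherent c y ->
  limit_at c g (a *: y + y') (a *: x + x').
Proof.
move=> lx lx' cy S; have [R HR] := lx S; have [R' HR'] := lx' S.
have [T [TR TR']] := open_submodI R R'; have [b bT] := cy T.
exists R' => b'; rewrite (sub_lincomb _ _ (c b)) => b'y.
(* Compare b' with a *: b, where b is a fixed approximation of y: the
   difference approximates y'. *)
have H : c (b' - a *: b) - y' \in R'.
  rewrite linearB linearZ_LR -[X in X \in _](addrK (a *: (c b - y))).
  by apply: submodB b'y _; exact: rpredZ (TR' _ bT).
rewrite (sub_lincomb _ _ (g b)) -linearZ_LR -linearB.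
by apply: rpredD; [exact: HR'|apply: rpredZ; exact: HR (TR _ bT)].
Qed.

Lemma lcmap_eq_dense B Y X (c : lcmap B Y) (h h' : lcmap Y X) :
  dense_image c -> (forall b, h (c b) = h' (c b)) -> h = h'.
Proof.
move=> dc e; apply: lcmapP => y; apply: topsc_eq => S.
have [R [RP RP']] := open_submodI (preim_open h S) (preim_open h' S).
have [b bR] := dc y R; have := RP' _ bR; have := RP _ bR.
rewrite /preim_open !mem_preim_submod !linearB e => P1 P2.
exact: submod_trans (submod_subC P1) P2.
Qed.

(** Extension by continuity, pointwise as a limit.  The universal property of
    cokernels is an instance. *)
Lemma dense_extension B Y X (c : lcmap B Y) (g : lcmap B X) :
  dense_image c -> induced_by c g -> exists h : lcmap Y X, forall b, h (c b) = g b.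
Proof.
move=> dc gc; have /choice[h Hh] : forall y, exists x, limit_at c g y x.
  by move=> y; exact: limit_atP.
have hl : linear h.
  by move=> a y y'; apply: limit_at_uniq (Hh _) (limit_at_lin _ _ _ _).
pose hL : {linear Y -> X} := HB.pack_for {linear Y -> X} h
  (GRing.isLinear.Build k Y X *:%R h hl).
have hc : continuous hL.
  apply/linear_continuousP => S; have [R HR] := gc S; exists R => y yR.
  (* h y is within S of g b for b close enough to y, and then c b is small. *)
  have [R' HR'] := Hh y S; have [T [TR TR']] := open_submodI R R'.
  have [b bT] := dc y T; apply: submod_cong (submod_subC (HR' _ (TR' _ bT))) _.
  by apply/HR/(submod_cong (TR _ bT)).
exists (LCMap hc) => b /=.
exact: limit_at_uniq (dc _) (Hh _) (limit_at_image b gc).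
Qed.

(** A complete subspace is closed: the limit of the identity of A along i is
    a preimage of the adherent point. *)
Lemma embedding_closed A B (i : lcmap A B) b :
  embedding i -> adherent i b -> exists a, i a = b.
Proof.
move=> ei ib; have [a Ha] := limit_atP ib ei; exists a; apply: topsc_eq => S.
have [R HR] := Ha (preim_open i S); have [T [TR TS]] := open_submodI R S.
have [a' a'T] := ib T; have := HR _ (TR _ a'T).
rewrite /preim_open mem_preim_submod linearB => H.
exact: submod_trans (submod_subC H) (TS _ a'T).
Qed.

Lemma embedding_inj A B (i : lcmap A B) a : embedding i -> i a = 0 -> a = 0.
Proof.
move=> ei e; apply: topsc_eq0 => S; have [R HR] := ei S.
by apply: HR; rewrite e rpred0.
Qed.
End Limits.

(** * Cokernels and pushouts *)

(** The vector space B with the open subspaces that contain the image of f.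
    It is not separated, but its separated completion agrees with that of the
    quotient of B by the image of f, so no quotient has to be formed. *)
Definition coker_space (k : fieldType) (A B : linTopType k) (f : lcmap A B)
  : Type := B.
HB.instance Definition _ (k : fieldType) (A B : linTopType k) (f : lcmap A B) :=
  GRing.Lmodule.on (coker_space f).

Section CokernelSpace.
Variables (k : fieldType) (A B : linTopType k) (f : lcmap A B).
Local Notation coker_space := (coker_space f).

Definition coker_base (P : submodClosed coker_space) : Prop :=
  exists2 Q : open_submod B, (forall x, (x \in P) = (x \in Q)) & forall a, f a \in Q.

Lemma coker_base_ex : exists P, coker_base P.
Proof.
pose T := mk_submod (A := [set: B]%classic) I (fun _ _ _ _ _ => I).
have oT : open [set` T]%classic.
  have [R _] := open_submodT B.
  by apply: open_submodS (osubmod_open R) _ => x _; apply/mem_mk_submod.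
exists T; exists (OpenSubmod oT) => // a; exact/mem_mk_submod.
Qed.

Lemma coker_baseI P Q : coker_base P -> coker_base Q ->
  exists R, [/\ coker_base R, {subset R <= P} & {subset R <= Q}].
Proof.
move=> [P' PP' fP'] [Q' QQ' fQ'].
have A0 : [set x : B | x \in P' /\ x \in Q']%classic 0 by split; exact: rpred0.
have AL c (x y : B) : [set x : B | x \in P' /\ x \in Q']%classic x ->
    [set x : B | x \in P' /\ x \in Q']%classic y ->
    [set x : B | x \in P' /\ x \in Q']%classic (c *: x + y).
  by move=> [xP xQ] [yP yQ]; split; exact: submod_lin.
have oR : open [set` mk_submod A0 AL]%classic.
  have [R [RP RQ]] := open_submodI P' Q'.
  apply: open_submodS (osubmod_open R) _ => x xR.
  by apply/mem_mk_submod; split; [exact: RP|exact: RQ].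
exists (mk_submod A0 AL); split.
- by exists (OpenSubmod oR) => // a; apply/mem_mk_submod.
- by move=> x /mem_mk_submod[xP _]; rewrite PP'.
- by move=> x /mem_mk_submod[_ xQ]; rewrite QQ'.
Qed.
HB.instance Definition _ :=
  Lmodule_isLinTop.Build k coker_space coker_base_ex coker_baseI.

Lemma open_cokerP (S : open_submod coker_space) :
  exists2 Q : open_submod B, {subset Q <= S} & forall a, f a \in Q.
Proof.
have : nbhs (0 : coker_space) [set` S]%classic.
  by apply: open_nbhs_nbhs; split; [exact: osubmod_open|exact: rpred0].
move=> [P [[Q PQ fQ] PS]]; exists Q => // x xQ.
have := PS x; rewrite add0r; apply; by rewrite PQ.
Qed.

Lemma open_coker (P : open_submod B) : (forall a, f a \in P) ->
  exists S : open_submod coker_space, forall x, (x \in S) = (x \in P).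
Proof.
move=> fP; have oS : open [set` (osubmod P : submodClosed coker_space)]%classic.
  apply: open_submod_nbhs; exists (osubmod P); split; first by exists P.
  by move=> v; rewrite add0r.
by exists (OpenSubmod oS).
Qed.

Definition coker_id (b : B) : coker_space := b.
Lemma coker_id_linear : linear coker_id. Proof. by []. Qed.
HB.instance Definition _ :=
  GRing.isLinear.Build k B coker_space *:%R coker_id coker_id_linear.

Lemma coker_id_continuous : continuous coker_id.
Proof.
by apply/linear_continuousP => S; have [Q QS _] := open_cokerP S; exists Q.
Qed.
Definition coker_lcmap : lcmap B (compl coker_space) :=
  lcmapM (to_compl_lcmap coker_space) (LCMap coker_id_continuous).
End CokernelSpace.

Section Cokernels.
Variable k : fieldType.
Implicit Types A B D X Y : topsc k.

(** The topology of B modulo the image of f is pulled back from Y along c. *)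
Definition strict_mod A B Y (f : lcmap A B) (c : lcmap B Y) :=
  forall P : open_submod B, (forall a, f a \in P) ->
    exists R : open_submod Y, forall b, c b \in R -> b \in P.

(** With [coker_elim], a description of the cokernels in terms of open
    subspaces: they are the completions of the quotients by the image.  The
    universal property is extension by continuity. *)
Lemma coker_intro A B Y (f : lcmap A B) (c : lcmap B Y) :
  (forall a, c (f a) = 0) -> dense_image c -> strict_mod f c ->
  @is_cokernel (TopSC k) A B Y f c.
Proof.
move=> cf0 dc sc; split; first exact: lcmapP.
move=> X g gf0.
have gfE a : g (f a) = 0 by exact: (congr1 (fun m : lcmap A X => m a) gf0).
have [|h hc] := @dense_extension _ _ _ _ c g dc.
  move=> S; have [a|R HR] := sc (preim_open g S).
    by rewrite /preim_open mem_preim_submod gfE rpred0.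
  by exists R => b /HR.
exists h; split; first exact: lcmapP.
move=> h' h'c; apply: (lcmap_eq_dense dc) => b; rewrite hc.
by rewrite -h'c.
Qed.

Lemma coker_exists A B (f : lcmap A B) : exists (Y : topsc k) (c : lcmap B Y),
  [/\ forall a, c (f a) = 0, dense_image c & strict_mod f c].
Proof.
exists (compl_topsc (coker_space f)), (coker_lcmap f); split.
- move=> a; apply: complP => P /=; apply/vproj0.
  by have [Q QP fQ] := open_cokerP P; exact: QP (fQ a).
- by move=> y S; exact: (@to_compl_dense _ (coker_space f)).
- move=> P /open_coker[S SP]; exists (OpenSubmod (@open_compl_ker _ _ S)) => b.
  by move=> /compl_kerP/vproj0; rewrite SP.
Qed.

(** A cokernel is isomorphic to the one of [coker_exists], and the three
    conditions are invariant under isomorphism. *)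
Lemma coker_elim A B Y (f : lcmap A B) (c : lcmap B Y) :
  @is_cokernel (TopSC k) A B Y f c ->
  [/\ forall a, c (f a) = 0, dense_image c & strict_mod f c].
Proof.
move=> kc; have [cf0 uc] := kc.
have [Y' [c' [c'f0 dc' sc']]] := coker_exists f.
have [c'f0m uc'] := coker_intro c'f0 dc' sc'.
have [u [uE _]] := uc Y' c' c'f0m; have [v [vE _]] := uc' Y c cf0.
have uEb b : u (c b) = c' b by rewrite -[RHS](congr1 (fun m : lcmap B Y' => m b) uE).
have vEb b : v (c' b) = c b by rewrite -[RHS](congr1 (fun m : lcmap B Y => m b) vE).
have vu y : v (u y) = y.
  have [w [_ wU]] := uc Y c cf0.
  have e1 : w = lcmapM v u by apply: wU; apply: lcmapP => b /=; rewrite uEb vEb.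
  have e2 : w = lcmap1 Y by apply: wU; exact: lcmapP.
  by have := congr1 (fun m : lcmap Y Y => m y) (etrans (esym e1) e2).
split.
- by move=> a; exact: (congr1 (fun m : lcmap A Y => m a) cf0).
- move=> y R; have [b bR] := dc' (u y) (preim_open v R); exists b.
  by move: bR; rewrite /preim_open mem_preim_submod linearB vEb vu.
- move=> P /sc'[R HR]; exists (preim_open u R) => b.
  by rewrite /preim_open mem_preim_submod uEb => /HR.
Qed.

Definition surjective_map A B (p : lcmap A B) := forall y, exists x, p x = y.

Definition open_map B D (p : lcmap B D) :=
  forall P : open_submod B, exists R : open_submod D,
    forall d, d \in R -> exists2 b, b \in P & p b = d.

Lemma open_add A B (i : lcmap A B) (P : open_submod B) :
  exists Q : open_submod B, forall b, b \in Q <-> exists a, b - i a \in P.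
Proof.
pose S := [set b : B | exists a, b - i a \in P]%classic.
have S0 : S 0 by exists 0; rewrite lcm0 subr0 rpred0.
have SL c x y : S x -> S y -> S (c *: x + y).
  move=> [a xa] [a' ya]; exists (c *: a + a').
  by rewrite lcmD lcmZ opprD addrACA -scalerBr; exact: submod_lin.
have oS : open [set` mk_submod S0 SL]%classic.
  apply: open_submodS (osubmod_open P) _ => x xP; apply/mem_mk_submod.
  by exists 0; rewrite lcm0 subr0.
by exists (OpenSubmod oS) => b; exact: mem_mk_submod.
Qed.

Lemma coker_open_add A B D (i : lcmap A B) (p : lcmap B D) (P : open_submod B) :
  @is_cokernel (TopSC k) A B D i p ->
  exists R : open_submod D, forall b, p b \in R -> exists a, b - i a \in P.
Proof.
move=> /coker_elim[_ _ sp]; have [Q HQ] := open_add i P.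
have [a|R HR] := sp Q; first by apply/HQ; exists a; rewrite subrr rpred0.
by exists R => b /HR/HQ.
Qed.

(** The kernel of a cokernel of i is the closure of the image of i, and that
    image is closed as A is complete. *)
Lemma embedding_coker_ker A B D (i : lcmap A B) (p : lcmap B D) b :
  embedding i -> @is_cokernel (TopSC k) A B D i p -> p b = 0 -> exists a, i a = b.
Proof.
move=> ei cp pb; apply: embedding_closed ei _ => P.
have [R HR] := coker_open_add P cp.
have [|a bP] := HR b; first by rewrite pb rpred0.
by exists a; exact: submod_subC.
Qed.

Lemma kernel_intro A B D (i : lcmap A B) (p : lcmap B D) :
  embedding i -> (forall a, p (i a) = 0) ->
  (forall b, p b = 0 -> exists a, i a = b) -> @is_kernel (TopSC k) A B D i p.
Proof.
move=> ei pi0 exi; split; first exact: lcmapP.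
move=> X f pf0.
have pfE x : p (f x) = 0 by exact: (congr1 (fun m : lcmap X D => m x) pf0).
have /choice[g gE] x : exists a, i a = f x by exact/exi/pfE.
have inj a a' : i a = i a' -> a = a'.
  move=> e; apply/subr0_eq/(embedding_inj ei).
  by rewrite linearB e subrr.
have gl : linear g by move=> c x y; apply: inj; rewrite linearP !gE linearP.
pose gL : {linear X -> A} := HB.pack_for {linear X -> A} g
  (GRing.isLinear.Build k X A *:%R g gl).
have gc : continuous gL.
  apply/linear_continuousP => P; have [Q HQ] := ei P.
  exists (preim_open f Q) => x; rewrite /preim_open mem_preim_submod => xQ.
  by apply: HQ => /=; rewrite gE.
exists (LCMap gc); split; first by apply: lcmapP => x /=; exact: gE.
move=> g' g'E; apply: lcmapP => x; apply: inj => /=; rewrite gE.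
by rewrite -g'E.
Qed.

Lemma open_coker_intro A B D (i : lcmap A B) (p : lcmap B D) :
  (forall a, p (i a) = 0) -> (forall b, p b = 0 -> exists a, i a = b) ->
  surjective_map p -> open_map p -> @is_cokernel (TopSC k) A B D i p.
Proof.
move=> pi0 exi sp op; apply: coker_intro => //.
  by move=> y R; have [b <-] := sp y; exists b; rewrite subrr rpred0.
move=> P iP; have [R HR] := op P; exists R => b /HR[b' b'P e].
have [|a ia] := exi (b - b'); first by rewrite linearB e subrr.
by apply: submod_cong b'P; rewrite -ia.
Qed.

(** A cokernel is the completion of a quotient map; when it is surjective
    there is nothing to complete, so it is a quotient map. *)
Lemma coker_open A B D (i : lcmap A B) (p : lcmap B D) :
  @is_cokernel (TopSC k) A B D i p -> surjective_map p -> open_map p.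
Proof.
move=> cp sp P; have [R HR] := coker_open_add P cp; exists R => d.
have [b <-] := sp d => /HR[a bP]; exists (b - i a) => //.
by have [pi0 _ _] := coker_elim cp; rewrite linearB pi0 subr0.
Qed.

(** Given by equations between its four maps, so that every additive functor
    preserves it. *)
Definition is_biproduct (C : additive_category) (B1 B2 P : C) (i1 : hom B1 P)
    (i2 : hom B2 P) (p1 : hom P B1) (p2 : hom P B2) :=
  [/\ p1 \oc i1 = idm B1, p2 \oc i2 = idm B2, p1 \oc i2 = 0,
      p2 \oc i1 = 0 & (i1 \oc p1) + (i2 \oc p2) = idm P].

(** The pushout Y of f along g is the cokernel of A -> B (+) X.  When
    A -> B -> D is strictly exact, Y is an extension of the complete space D
    by the complete space X, hence the quotient of B (+) X by A is already
    complete. *)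
Section Pushout.
Variables (A B X D P Y : topsc k) (f : lcmap A B) (g : lcmap A X) (p : lcmap B D).
Variables (i1 : lcmap B P) (i2 : lcmap X P) (p1 : lcmap P B) (p2 : lcmap P X).
Variable c : lcmap P Y.
Hypothesis ef : embedding f.
Hypothesis cp : @is_cokernel (TopSC k) A B D f p.
Hypothesis sp : surjective_map p.
Hypothesis bi : @is_biproduct (TopSC k) B X P i1 i2 p1 p2.
Hypothesis cc : @is_cokernel (TopSC k) A P Y (lcmapM i1 f - lcmapM i2 g) c.

Let p1i1 b : p1 (i1 b) = b.
Proof. by have [e _ _ _ _] := bi; exact: (congr1 (fun m : lcmap B B => m b) e). Qed.
Let p2i2 b : p2 (i2 b) = b.
Proof. by have [_ e _ _ _] := bi; exact: (congr1 (fun m : lcmap X X => m b) e). Qed.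
Let p1i2 b : p1 (i2 b) = 0.
Proof. by have [_ _ e _ _] := bi; exact: (congr1 (fun m : lcmap X B => m b) e). Qed.
Let p2i1 b : p2 (i1 b) = 0.
Proof. by have [_ _ _ e _] := bi; exact: (congr1 (fun m : lcmap B X => m b) e). Qed.
Let bipE x : i1 (p1 x) + i2 (p2 x) = x.
Proof. by have [_ _ _ _ e] := bi; exact: (congr1 (fun m : lcmap P P => m x) e). Qed.
Let dE a : (lcmapM i1 f - lcmapM i2 g) a = i1 (f a) - i2 (g a).
Proof. by []. Qed.
Let cE a : c (i1 (f a)) = c (i2 (g a)).
Proof.
have [/(_ a) e _ _] := coker_elim cc; apply/subr0_eq.
by rewrite -lcmB -dE.
Qed.

(* If c x is small, then x is small up to the image of A, in both components
   at once. *)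
Let opens (U : open_submod B) (W : open_submod X) : exists R : open_submod Y,
  forall x, c x \in R -> exists a, p1 x - f a \in U /\ p2 x + g a \in W.
Proof.
have [T [TU TW]] := open_submodI (preim_open p1 U) (preim_open p2 W).
have [R HR] := coker_open_add T cc; exists R => x /HR[a xT]; exists a.
have := TU _ xT; have := TW _ xT; rewrite /preim_open !mem_preim_submod.
by rewrite dE !lcmB p1i1 p1i2 p2i1 p2i2 subr0 sub0r opprK.
Qed.

(** If c (i2 x) is small then x is close to some - g a with f a small, and
    f a small makes g a small because f is an embedding. *)
Lemma pushout_embedding : embedding (lcmapM c i2).
Proof.
move=> W; have [U HU] := ef (preim_open g W).
have [R HR] := opens U W; exists R => x /= /HR[a].
rewrite p1i2 p2i2 sub0r => -[fU xW].
have := HU a; rewrite -[f a]opprK => /(_ (submodN fU)).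
rewrite /preim_open mem_preim_submod => ga.
by rewrite -[x](addrK (g a)); exact: submodB xW ga.
Qed.

(** Modulo c (i1 b) for a suitable b, any y lies in the kernel of the map
    s : Y -> D.  Points of that kernel are adherent to the image of X, and
    this image is closed because it is a complete subspace. *)
Lemma pushout_surjective : surjective_map c.
Proof.
have [s [sE _]] : exists! s : lcmap Y D, lcmapM s c = lcmapM p p1.
  have [_ uc] := cc; apply: uc; apply: lcmapP => a.
  rewrite -[LHS]/(p (p1 ((lcmapM i1 f - lcmapM i2 g) a))).
  rewrite dE lcmB p1i1 p1i2 subr0.
  by have [pf0 _ _] := coker_elim cp; exact: pf0.
have sc x : s (c x) = p (p1 x) by exact: (congr1 (fun m : lcmap P D => m x) sE).
move=> y; have [b pb] := sp (s y); pose y' := y - c (i1 b).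
have sy' : s y' = 0 by rewrite /y' lcmB sc p1i1 pb subrr.
suff [x cx] : exists x, lcmapM c i2 x = y'.
  by exists (i1 b + i2 x); rewrite lcmD /= -[c (i2 x)]/(lcmapM c i2 x) cx addrC subrK.
apply: embedding_closed pushout_embedding _ => R.
(* Take x with c x close to y'.  Then p (p1 x) = s (c x - y') is small, hence
   lifts to a small u as p is open; p1 x - u comes from A and can be moved to
   the second component. *)
have [V HV] := coker_open cp sp (preim_open (lcmapM c i1) R).
have [T [TR TV]] := open_submodI R (preim_open s V).
have [_ dc _] := coker_elim cc; have [x xT] := dc y' T.
have := TV _ xT; rewrite /preim_open mem_preim_submod lcmB sy' subr0 sc.
move=> /HV[u]; rewrite mem_preim_submod => uR pu.
have [|a fa] := @embedding_coker_ker _ _ _ f p (p1 x - u) ef cp.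
  by rewrite lcmB pu subrr.
exists (p2 x + g a).
have -> : lcmapM c i2 (p2 x + g a) = c x - lcmapM c i1 u.
  rewrite lcmD -[in RHS](bipE x) lcmD -[lcmapM c i1 u]/(c (i1 u)).
  rewrite -[lcmapM c i2 (g a)]/(c (i2 (g a))) -cE fa !lcmB addrA.
  by rewrite [_ + c (i1 (p1 x))]addrC.
by rewrite addrAC; exact: submodB (TR _ xT) uR.
Qed.
End Pushout.
End Cokernels.

(** * Kernels and the largest exact structure *)

(** Kernels in the category are subspaces with the induced topology; they are
    used to build pullbacks and to recognise kernels as embeddings. *)
Definition subspace (k : fieldType) (V : linTopType k) (S : submodClosed V) :=
  {x : V | x \in S}.

Section Subspace.
Variables (k : fieldType) (V : linTopType k) (S : submodClosed V).
Local Notation subspace := (subspace S).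

HB.instance Definition _ := SubChoice.on subspace.
HB.instance Definition _ := [SubChoice_isSubLmodule of subspace by <:].

Definition subspace_incl (x : subspace) : V := val x.
Lemma subspace_incl_linear : linear subspace_incl.
Proof. by []. Qed.
HB.instance Definition _ :=
  GRing.isLinear.Build k subspace V *:%R subspace_incl subspace_incl_linear.

Definition trace (P : open_submod V) : submodClosed subspace :=
  mk_submod (A := [set x | subspace_incl x \in P]%classic)
    (rpred0 P) (fun c u v uP vP => submod_lin c uP vP).

Definition subspace_base (Q : submodClosed subspace) := exists P, Q = trace P.

Lemma subspace_base_ex : exists Q, subspace_base Q.
Proof. by have [P _] := open_submodT V; exists (trace P), P. Qed.

Lemma traceS (P Q : open_submod V) : {subset P <= Q} -> {subset trace P <= trace Q}.
Proof. by move=> PQ x /mem_mk_submod xP; apply/mem_mk_submod/PQ. Qed.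

Lemma subspace_baseI Q Q' : subspace_base Q -> subspace_base Q' ->
  exists R, [/\ subspace_base R, {subset R <= Q} & {subset R <= Q'}].
Proof.
move=> [P ->] [P' ->]; have [R [RP RP']] := open_submodI P P'.
by exists (trace R); split; [exists R|exact: traceS|exact: traceS].
Qed.
HB.instance Definition _ :=
  Lmodule_isLinTop.Build k subspace subspace_base_ex subspace_baseI.

Lemma open_trace P : open [set` trace P]%classic.
Proof.
apply: open_submod_nbhs; exists (trace P); split; first by exists P.
by move=> v; rewrite add0r.
Qed.
Definition otrace P := OpenSubmod (@open_trace P).

Lemma open_traceP (Q : open_submod subspace) : exists P, {subset trace P <= Q}.
Proof.
have : nbhs (0 : subspace) [set` Q]%classic.
  by apply: open_nbhs_nbhs; split; [exact: osubmod_open|exact: rpred0].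
by move=> [_ [[P ->] PQ]]; exists P => x /PQ; rewrite add0r.
Qed.

Lemma subspace_incl_continuous : continuous subspace_incl.
Proof. by apply/linear_continuousP => P; exists (otrace P) => x /mem_mk_submod. Qed.
Definition subspace_lcmap : lcmap subspace V := LCMap subspace_incl_continuous.
End Subspace.

Section Kernel.
Variables (k : fieldType) (V W : topsc k) (h : lcmap V W).

Definition ker_set : set V := [set x | h x = 0]%classic.
Lemma ker_set0 : ker_set 0. Proof. exact: lcm0. Qed.
Lemma ker_setL c u v : ker_set u -> ker_set v -> ker_set (c *: u + v).
Proof. by rewrite /ker_set/= lcmD lcmZ => -> ->; rewrite scaler0 addr0. Qed.
Definition ker_submod := mk_submod ker_set0 ker_setL.
Local Notation K := (subspace ker_submod).

Lemma ker_separated : lin_separated K.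
Proof.
move=> x y e; apply/val_inj/topsc_eq => P.
have /vprojP/mem_mk_submod : vproj (otrace _ P) x = vproj (otrace _ P) y.
  exact: (congr1 (fun z : compl K => z (otrace _ P)) e).
by [].
Qed.

(** A Cauchy net in the kernel of h converges in V, and its limit is killed by
    h as W is separated. *)
Lemma ker_complete : lin_complete K.
Proof.
move=> y; pose z P : K := vrepr (y (otrace ker_submod P)).
have [P Q PQ|x Hx] := @topsc_limit _ V (fun P => val (z P)).
  have /vprojP/mem_mk_submod : vproj (otrace _ Q) (z P) = vproj (otrace _ Q) (z Q).
    rewrite [RHS]vreprK; apply/esym/compl_repr.
    exact: traceS.
  by [].
have x0 : x \in ker_submod.
  apply/mem_mk_submod; apply: topsc_eq0 => R.
  have := Hx (preim_open h R); rewrite mem_preim_submod lcmB.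
  suff -> : h (val (z (preim_open h R))) = 0 by rewrite subr0.
  by have /mem_mk_submod := valP (z (preim_open h R)).
exists (Sub x x0 : K); apply: complP => Q.
have [P PQ] := open_traceP Q.
apply/esym/(@compl_compat _ _ y (otrace _ P) Q) => //.
rewrite -[LHS]vreprK; apply/vprojP/mem_mk_submod.
exact/submod_subC/Hx.
Qed.

Definition ker_topsc : topsc k := TopscObj ker_separated ker_complete.
Definition ker_lcmap : lcmap ker_topsc V := subspace_lcmap ker_submod.

Lemma ker_lcmap0 x : h (ker_lcmap x) = 0.
Proof. by have /mem_mk_submod := valP (x : K). Qed.

Lemma ker_lcmap_ex v : h v = 0 -> exists x, ker_lcmap x = v.
Proof.
move=> hv; have hv' : v \in ker_submod by exact/mem_mk_submod.
by exists (Sub v hv' : K).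
Qed.

Lemma ker_embedding : embedding ker_lcmap.
Proof.
move=> Q; have [P PQ] := open_traceP Q; exists P => x xP; apply: PQ.
exact/mem_mk_submod.
Qed.
End Kernel.

(** Any kernel is isomorphic to the subspace ker p. *)
Lemma kernel_elim (k : fieldType) (A B D : topsc k) (i : lcmap A B) (p : lcmap B D) :
  @is_kernel (TopSC k) A B D i p ->
  [/\ embedding i, forall a, p (i a) = 0 & forall b, p b = 0 -> exists a, i a = b].
Proof.
move=> [pi0 ui].
have [|u [uE _]] := ui (ker_topsc p) (ker_lcmap p).
  by apply: lcmapP => x; exact: ker_lcmap0.
have uEx x : i (u x) = ker_lcmap p x.
  by exact: (congr1 (fun m : lcmap (ker_topsc p) B => m x) uE).
have pi0a a : p (i a) = 0 by exact: (congr1 (fun m : lcmap A D => m a) pi0).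
have [_ /(_ A i pi0)[v [vE _]]] := kernel_intro (ker_embedding (h := p))
  (@ker_lcmap0 _ _ _ p) (@ker_lcmap_ex _ _ _ p).
have vEx x : ker_lcmap p (v x) = i x.
  by exact: (congr1 (fun m : lcmap A B => m x) vE).
have uv a : u (v a) = a.
  have [w [_ wU]] := ui A i pi0.
  have e1 : w = lcmapM u v by apply: wU; apply: lcmapP => x /=; rewrite uEx vEx.
  have e2 : w = lcmap1 A by apply: wU; exact: lcmapP.
  by have := congr1 (fun m : lcmap A A => m a) (etrans (esym e1) e2).
split=> //.
- move=> P; have [Q HQ] := ker_embedding (preim_open u P).
  exists Q => a; rewrite -vEx => /HQ.
  by rewrite /preim_open mem_preim_submod /= uv.
- by move=> b /ker_lcmap_ex[x <-]; exists (u x).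
Qed.

(** The discrete one-dimensional space: maps from it to D are the points of D,
    which turns statements about arrows into D into statements about points. *)
Definition discrete_line (k : fieldType) : Type := k^o.

Section Line.
Variable k : fieldType.
HB.instance Definition _ := GRing.Lmodule.on (discrete_line k).
Local Notation L := (discrete_line k).

Lemma line_zero_closed c (x y : L) : [set 0]%classic x -> [set 0]%classic y ->
  [set 0]%classic (c *: x + y).
Proof. by move=> -> ->; rewrite scaler0 addr0. Qed.
Definition line0 : submodClosed L :=
  mk_submod (erefl : [set 0 : L]%classic 0) line_zero_closed.

Lemma line_base_ex : exists P : submodClosed L, P = line0.
Proof. by exists line0. Qed.
Lemma line_baseI (P Q : submodClosed L) : P = line0 -> Q = line0 ->
  exists R, [/\ R = line0, {subset R <= P} & {subset R <= Q}].
Proof. by move=> -> ->; exists line0; split. Qed.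
HB.instance Definition _ := Lmodule_isLinTop.Build k L line_base_ex line_baseI.

Lemma open_line0 : open [set` line0]%classic.
Proof.
apply: open_submod_nbhs; exists line0; split=> // v; by rewrite add0r.
Qed.
Definition oline0 : open_submod L := OpenSubmod open_line0.

Lemma line_separated : lin_separated L.
Proof.
move=> x y e; apply/subr0_eq.
suff /vprojP/mem_mk_submod : vproj oline0 x = vproj oline0 y by [].
exact: (congr1 (fun z : compl L => z oline0) e).
Qed.
Lemma line_complete : lin_complete L.
Proof.
move=> y; exists (vrepr (y oline0)); apply: complP => P /=.
rewrite -(@compl_repr _ _ y oline0 P) // => x /mem_mk_submod ->.
exact: rpred0.
Qed.
Definition line_topsc : topsc k := TopscObj line_separated line_complete.

Variables (D : topsc k) (d : D).
Definition line_map (c : L) : D := (c : k) *: d.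
Lemma line_map_linear : linear line_map.
Proof. by move=> a x y; rewrite /line_map scalerDl scalerA. Qed.
HB.instance Definition _ :=
  GRing.isLinear.Build k L D *:%R line_map line_map_linear.
Lemma line_map_continuous : continuous line_map.
Proof.
apply/linear_continuousP => Q; exists oline0 => x /mem_mk_submod ->.
by rewrite raddf0 rpred0.
Qed.
Definition line_lcmap : lcmap line_topsc D := LCMap line_map_continuous.
End Line.

Section Strict.
Variable k : fieldType.
Local Notation TopSC := (TopSC k).

(** The short exact sequences of the largest exact structure on the category;
    the surjectivity condition is what distinguishes them from the
    kernel-cokernel pairs, whose second map may only have dense image. *)
Definition strict_ses : seq_class TopSC := fun A B D i p =>
  [/\ embedding i, @is_cokernel TopSC A B D i p & surjective_map p].

(** Pull back the admissible epimorphism p along the map from the line to D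
    with image spanned by d.  The result is an epimorphism onto the line,
    hence nonzero, so that a nonzero multiple of d is a value of p. *)
Lemma exact_structure_strict (F : seq_class TopSC) :
  exact_structure F -> sub_class F strict_ses.
Proof.
move=> eF A B D i p Fip.
have /kernel_elim[ei _ _] := ex_ker eF Fip.
have cp := ex_coker eF Fip; split=> // d.
have [|B' [a [b [[sq _] [A' [j Fjb]]]]]] :=
  ex_pullback eF (f := p) (line_lcmap d); first by exists A, i.
have [_ ub] := ex_coker eF Fjb.
have [[x bx]|nb] := pselect (exists x, b x <> 0); last first.
  have b0 : b = 0.
    by apply: lcmapP => x; apply: contrapT => bx; apply: nb; exists x.
  have [|w [_ wU]] := ub (line_topsc k) 0; first exact: lcmapP.
  have e1 : w = lcmap1 (line_topsc k).
    by apply: wU; rewrite b0; apply: lcmapP.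
  have e2 : w = 0 by apply: wU; rewrite b0; apply: lcmapP.
  have /eqP := congr1 (fun m : lcmap (line_topsc k) (line_topsc k) => m (1 : k))
    (etrans (esym e1) e2).
  by rewrite /= oner_eq0.
have pE : p (a x) = (b x : k) *: d.
  exact: (congr1 (fun m : lcmap B' D => m x) sq).
exists ((b x : k)^-1 *: a x); rewrite lcmZ pE scalerA mulVf ?scale1r //.
exact/eqP.
Qed.
End Strict.

(** * Extension of bilinear maps and tensor products *)

Section Bilinear.
Variables (k : fieldType) (U V W : lmodType k) (b : U -> V -> W).
Hypothesis bil : bilinear_map b.

Lemma bilDl u u' v : b (u + u') v = b u v + b u' v.
Proof. by have [bl _] := bil; have := bl 1 u u' v; rewrite !scale1r. Qed.
Lemma bilDr u v v' : b u (v + v') = b u v + b u v'.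
Proof. by have [_ br] := bil; have := br 1 u v v'; rewrite !scale1r. Qed.
Lemma bilBr u v v' : b u (v - v') = b u v - b u v'.
Proof.
have [_ br] := bil; have := br (-1) u v' v.
by rewrite !scaleN1r addrC [RHS]addrC.
Qed.
Lemma bil0l v : b 0 v = 0.
Proof. by apply: (addrI (b 0 v)); rewrite -bilDl !addr0. Qed.
Lemma bil0r u : b u 0 = 0.
Proof. by apply: (addrI (b u 0)); rewrite -bilDr !addr0. Qed.
End Bilinear.

Lemma tens_bilinear (k : fieldType) (U V : lmodType k) :
  bilinear_map (@tens k U V).
Proof. by split=> *; rewrite ?tens_linl ?tens_linr. Qed.

Lemma tens_lift_map (k : fieldType) (U V U' V' W : lmodType k)
    (b : U' -> V' -> W) (f : {linear U -> U'}) (g : {linear V -> V'})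
    (h : {linear tensor U V -> W}) :
  bilinear_map b -> (forall u v, b (f u) (g v) = h (tens u v)) ->
  forall x, tens_lift b (tens_map f g x) = h x.
Proof.
move=> bb e x; pose T := [set x | tens_lift b (tens_map f g x) = h x]%classic.
have ll := tens_lift_linear bb.
have T0 : T 0.
  rewrite /T /= !raddf0 -(bil0l bb 0) -(tens_lift_tens bb).
  by rewrite (bil0l (tens_bilinear _ _)).
have TL a y z : T y -> T z -> T (a *: y + z).
  by rewrite /T /= (tens_map_lin f g) ll linearP => -> ->.
apply/(mem_mk_submod T0 TL); apply: tensor_ind => u v; apply/mem_mk_submod.
by rewrite /T /= tens_mapE (tens_lift_tens bb).
Qed.

(** A bilinear map m on U * B that kills the image of f in B and is continuous
    in its second variable extends to the cokernel Y of f, with values in the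
    same space, because that space is thought of as discrete: for each u, the
    value m u b depends only on c b modulo some open subspace.  Joint
    continuity properties of m pass to the extension. *)
Section BilinearExtension.
Variables (k : fieldType) (U : lmodType k) (A B Y : topsc k) (M : lmodType k).
Variables (f : lcmap A B) (c : lcmap B Y) (m : U -> B -> M).
Hypothesis (dc : dense_image c) (sc : strict_mod f c).
Hypothesis bm : bilinear_map m.
Hypothesis mf : forall u a, m u (f a) = 0.

(** The b that are killed by all u in S form a subspace; it is open as it
    contains Q, and it contains the image of f. *)
Lemma strict_mod_bilinear (S : U -> Prop) (Q : open_submod B) :
  (forall u b, S u -> b \in Q -> m u b = 0) ->
  exists R : open_submod Y, forall u b, S u -> c b \in R -> m u b = 0.
Proof.
move=> mQ; pose T := [set b : B | forall u, S u -> m u b = 0]%classic.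
have T0 : T 0 by move=> u _; exact: bil0r.
have TL a x y : T x -> T y -> T (a *: x + y).
  move=> Tx Ty u Su; have [_ ->] := bm.
  by rewrite Tx // Ty // scaler0 addr0.
have oT : open [set` mk_submod T0 TL]%classic.
  apply: open_submodS (osubmod_open Q) _ => x xQ; apply/mem_mk_submod => u Su.
  exact: mQ.
have [|R HR] := sc (P := OpenSubmod oT).
  by move=> a; apply/mem_mk_submod => u _; exact: mf.
by exists R => u b Su /HR/mem_mk_submod; apply.
Qed.

Hypothesis mQ : forall u, exists Q : open_submod B, forall b, b \in Q -> m u b = 0.

(** R depends on u only, so that finitely many conditions on approximations of
    a given y can be met at once. *)
Definition extends_along (beta : U -> Y -> M) :=
  forall u, exists R : open_submod Y, forall y b, c b - y \in R -> beta u y = m u b.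

Lemma bilinear_extension : exists beta, bilinear_map beta /\ extends_along beta.
Proof.
have /choice[R HR] u : exists R : open_submod Y, forall b, c b \in R -> m u b = 0.
  have [Q HQ] := mQ u.
  have [|R HR] := @strict_mod_bilinear (fun u' => u' = u) Q.
    by move=> _ b -> /HQ.
  by exists R => b; exact: HR.
have /choice[ap Hap] (uy : U * Y) : exists b, c b - uy.2 \in R uy.1 by exact: dc.
pose beta u y := m u (ap (u, y)).
have ext u y b : c b - y \in R u -> beta u y = m u b.
  move=> bR; apply/subr0_eq; rewrite /beta -(bilBr bm); apply: HR.
  by rewrite lcmB; exact: submod_trans (Hap (u, y)) (submod_subC bR).
exists beta; split; last by move=> u; exists (R u) => y b; exact: ext.
have [ml mr] := bm; split.
- move=> a u u' y; have [T [T1 T2]] := open_submodI (R u) (R u').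
  have [T' [T'T T3]] := open_submodI T (R (a *: u + u')).
  have [b bT] := dc y T'.
  by rewrite (ext _ _ _ (T1 _ (T'T _ bT))) (ext _ _ _ (T2 _ (T'T _ bT)))
    (ext _ _ _ (T3 _ bT)) ml.
- move=> a u y y'; have [b bR] := dc y (R u); have [b' bR'] := dc y' (R u).
  rewrite (ext _ _ _ bR) (ext _ _ _ bR') -mr; apply: ext.
  rewrite lcmD lcmZ opprD addrACA -scalerBr.
  by apply: rpredD => //; exact: rpredZ.
Qed.

Variable beta : U -> Y -> M.
Hypothesis (bbeta : bilinear_map beta) (ebeta : extends_along beta).

Lemma extension_image u b : beta u (c b) = m u b.
Proof. by have [R HR] := ebeta u; apply: HR; rewrite subrr rpred0. Qed.

Lemma extension_eq0 u y : (forall b, m u b = 0) -> beta u y = 0.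
Proof.
by move=> m0; have [R HR] := ebeta u; have [b bR] := dc y R; rewrite (HR _ _ bR).
Qed.

Lemma extension_open (S : U -> Prop) (Q : open_submod B) :
  (forall u b, S u -> b \in Q -> m u b = 0) ->
  exists R : open_submod Y, forall u y, S u -> y \in R -> beta u y = 0.
Proof.
move=> /strict_mod_bilinear[R HR]; exists R => u y Su yR.
have [R' HR'] := ebeta u; have [T [TR TR']] := open_submodI R R'.
have [b bT] := dc y T; rewrite (HR' _ _ (TR' _ bT)); apply: HR => //.
exact: submod_cong (TR _ bT) yR.
Qed.

(** On S, the function beta ^~ y coincides with m ^~ b as soon as c b - y is
    killed by S; this is how continuity in the first variable at y is
    inherited from that of m at b. *)
Lemma extension_approx (S : U -> Prop) (R : open_submod Y) y :
  (forall u y, S u -> y \in R -> beta u y = 0) ->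
  exists b, forall u, S u -> beta u y = m u b.
Proof.
move=> HR; have [b bR] := dc y R; exists b => u Su.
by rewrite -extension_image; apply/esym/subr0_eq; rewrite -(bilBr bbeta) HR.
Qed.
End BilinearExtension.

Section TensorCokernel.
Variables (k : fieldType) (t : tensor_kind) (A B Y : topsc k).
Variables (f : lcmap A B) (c : lcmap B Y).
Hypothesis (dc : dense_image c) (sc : strict_mod f c).
Variable U : topsc k.

Lemma tens_open_section (V W : linTopType k) (E : submodClosed (tensor V W)) :
  tens_open t E ->
  (forall v, exists Q : open_submod W, forall w, w \in Q -> tens v w \in E) /\
  (forall w, exists P : open_submod V, forall v, v \in P -> tens v w \in E).
Proof.
rewrite /tens_open; case: t.
- by case.
- by move=> [[P PE] QE]; split=> // w; exists P => v; exact: PE.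
- move=> [P [Q [PE QE]]]; split=> [v|w]; first by exists Q => w; exact: QE.
  by exists P => v; exact: PE.
Qed.

(** Extend the bilinear map (u, b) |-> u (x) b with values in the quotient by E
    to U * Y, and let E' be the kernel of the induced linear map on the tensor
    product. *)
Lemma tens_strict_r (E : submodClosed (tensor U B)) :
  tens_open t E -> (forall u a, tens u (f a) \in E) ->
  exists E' : submodClosed (tensor U Y), tens_open t E' /\
    forall x, tens_map (lcmap1 U) c x \in E' -> x \in E.
Proof.
move=> oE fE; have [sE _] := tens_open_section oE.
pose m (u : U) (b : B) := vproj E (tens u b).
have bm : bilinear_map m.
  by split=> *; rewrite /m ?tens_linl ?tens_linr linearP.
have mE u b : m u b = 0 <-> tens u b \in E by exact: vproj0.
have mf u a : m u (f a) = 0 by apply/mE/fE.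
have mQ u : exists Q : open_submod B, forall b, b \in Q -> m u b = 0.
  by have [Q HQ] := sE u; exists Q => b /HQ/mE.
have [beta [bb eb]] := bilinear_extension dc sc bm mf mQ.
have opn := extension_open dc sc bm mf eb.
have apx := extension_approx dc bb eb.
have zer := extension_eq0 dc eb.
pose T := [set z | tens_lift beta z = 0]%classic.
pose ll := tens_lift_linear bb.
have T0 : T 0 by rewrite /T /= -(bil0l bb 0) -(tens_lift_tens bb) (bil0l (tens_bilinear _ _)).
have TL a x y : T x -> T y -> T (a *: x + y).
  by rewrite /T /= ll => -> ->; rewrite scaler0 addr0.
have tT u y : tens u y \in mk_submod T0 TL <-> beta u y = 0.
  by rewrite mem_mk_submod /T /= (tens_lift_tens bb).
have section u : exists R : open_submod Y, forall y, y \in R -> tens u y \in mk_submod T0 TL.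
  have [Q HQ] := mQ u; have [|R HR] := opn (fun u' => u' = u) Q.
    by move=> _ b -> /HQ.
  by exists R => y yR; apply/tT/HR.
exists (mk_submod T0 TL); split.
- move: oE; rewrite /tens_open; case: t => [[[P [Q PQ]] _ rE]|[[P PE] _]|[P [Q [PE QE]]]].
  + have [|R HR] := opn (fun u => u \in P) Q; first by move=> u b uP bQ; apply/mE/PQ.
    split=> //.
      by exists P, R => u y uP yR; apply/tT/HR.
    move=> y; have [b Hb] := apx (fun u => u \in P) R y HR.
    have [P' HP'] := rE b; have [P2 [P2P P2P']] := open_submodI P P'.
    by exists P2 => u uP; apply/tT; rewrite Hb ?(P2P _ uP) //; apply/mE/HP'/P2P'.
  + split=> //; exists P => u y uP; apply/tT/zer => b; exact/mE/PE.
  + have [|R HR] := opn (fun _ => True) Q; first by move=> u b _ bQ; apply/mE/QE.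
    exists P, R; split=> u y H; apply/tT; last exact: HR.
    by apply: zer => b; exact/mE/PE.
- move=> x /mem_mk_submod xT; apply/vproj0; rewrite -xT.
  by apply/esym/(tens_lift_map bb) => u b; exact: (extension_image eb).
Qed.

(** The mirror image of [tens_strict_r].  The two are not formal consequences
    of each other, since the topology of kind [Arrow] is not symmetric. *)
Lemma tens_strict_l (E : submodClosed (tensor B U)) :
  tens_open t E -> (forall a u, tens (f a) u \in E) ->
  exists E' : submodClosed (tensor Y U), tens_open t E' /\
    forall x, tens_map c (lcmap1 U) x \in E' -> x \in E.
Proof.
move=> oE fE; have [_ sE] := tens_open_section oE.
pose m (u : U) (b : B) := vproj E (tens b u).
have bm : bilinear_map m.
  by split=> *; rewrite /m ?tens_linl ?tens_linr linearP.
have mE u b : m u b = 0 <-> tens b u \in E by exact: vproj0.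
have mf u a : m u (f a) = 0 by apply/mE/fE.
have mQ u : exists Q : open_submod B, forall b, b \in Q -> m u b = 0.
  by have [Q HQ] := sE u; exists Q => b /HQ/mE.
have [beta [bb eb]] := bilinear_extension dc sc bm mf mQ.
have opn := extension_open dc sc bm mf eb.
have apx := extension_approx dc bb eb.
have zer := extension_eq0 dc eb.
have bb' : bilinear_map (fun y u => beta u y) by have [bl br] := bb; split.
pose T := [set z | tens_lift (fun y u => beta u y) z = 0]%classic.
pose ll := tens_lift_linear bb'.
have T0 : T 0.
  by rewrite /T /= -(bil0l bb' 0) -(tens_lift_tens bb') (bil0l (tens_bilinear _ _)).
have TL a x y : T x -> T y -> T (a *: x + y).
  by rewrite /T /= ll => -> ->; rewrite scaler0 addr0.
have tT y u : tens y u \in mk_submod T0 TL <-> beta u y = 0.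
  by rewrite mem_mk_submod /T /= (tens_lift_tens bb').
have section u : exists R : open_submod Y, forall y, y \in R -> tens y u \in mk_submod T0 TL.
  have [Q HQ] := mQ u; have [|R HR] := opn (fun u' => u' = u) Q.
    by move=> _ b -> /HQ.
  by exists R => y yR; apply/tT/HR.
exists (mk_submod T0 TL); split.
- move: oE; rewrite /tens_open; case: t => [[[P [Q PQ]] rE _]|[[P PE] rE]|[P [Q [PE QE]]]].
  + have [|R HR] := opn (fun u => u \in Q) P; first by move=> u b uQ bP; apply/mE/PQ.
    split=> //.
      by exists R, Q => y u yR uQ; apply/tT/HR.
    move=> y; have [b Hb] := apx (fun u => u \in Q) R y HR.
    have [Q' HQ'] := rE b; have [Q2 [Q2Q Q2Q']] := open_submodI Q Q'.
    by exists Q2 => u uQ; apply/tT; rewrite Hb ?(Q2Q _ uQ) //; apply/mE/HQ'/Q2Q'.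
  + have [|R HR] := opn (fun _ => True) P; first by move=> u b _ bP; apply/mE/PE.
    split; first by exists R => y u yR; apply/tT/HR.
    move=> y; have [b Hb] := apx (fun _ => True) R y HR.
    have [Q' HQ'] := rE b.
    by exists Q' => u uQ; apply/tT; rewrite Hb //; apply/mE/HQ'.
  + have [|R HR] := opn (fun _ => True) P; first by move=> u b _ bP; apply/mE/PE.
    exists R, Q; split=> y u H; apply/tT; first exact: HR.
    by apply: zer => b; exact/mE/QE.
- move=> x /mem_mk_submod xT; apply/vproj0; rewrite -xT.
  by apply/esym/(tens_lift_map bb') => b u; exact: (extension_image eb).
Qed.

Lemma tens_dense_r (z : tens_top t U Y) (E : open_submod (tens_top t U Y)) :
  exists x, tens_lcmap t (lcmap1 U) c x - z \in E.
Proof.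
have /open_tensP/tens_open_section[sE _] := osubmod_open E.
pose T := [set z : tens_top t U Y | exists x, tens_lcmap t (lcmap1 U) c x - z \in E]%classic.
have T0 : T 0 by exists 0; rewrite lcm0 subrr rpred0.
have TL a x y : T x -> T y -> T (a *: x + y).
  move=> [x' xE] [y' yE]; exists (a *: x' + y').
  by rewrite lcmD lcmZ opprD addrACA -scalerBr; exact: submod_lin.
apply/(mem_mk_submod T0 TL); apply: (@tensor_ind k U Y (mk_submod T0 TL)) => u y.
apply/mem_mk_submod; have [Q HQ] := sE u; have [b bQ] := dc y Q.
exists (tens u b); have -> : tens_lcmap t (lcmap1 U) c (tens u b) = tens u (c b).
  exact: tens_mapE.
by have := HQ _ bQ; rewrite (bilBr (tens_bilinear U Y)).
Qed.

Lemma tens_dense_l (z : tens_top t Y U) (E : open_submod (tens_top t Y U)) :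
  exists x, tens_lcmap t c (lcmap1 U) x - z \in E.
Proof.
have /open_tensP/tens_open_section[_ sE] := osubmod_open E.
pose T := [set z : tens_top t Y U | exists x, tens_lcmap t c (lcmap1 U) x - z \in E]%classic.
have T0 : T 0 by exists 0; rewrite lcm0 subrr rpred0.
have TL a x y : T x -> T y -> T (a *: x + y).
  move=> [x' xE] [y' yE]; exists (a *: x' + y').
  by rewrite lcmD lcmZ opprD addrACA -scalerBr; exact: submod_lin.
apply/(mem_mk_submod T0 TL); apply: (@tensor_ind k Y U (mk_submod T0 TL)) => y u.
apply/mem_mk_submod; have [Q HQ] := sE u; have [b bQ] := dc y Q.
exists (tens b u); have -> : tens_lcmap t c (lcmap1 U) (tens b u) = tens (c b) u.
  exact: tens_mapE.
have bb' : bilinear_map (fun u y => @tens k Y U y u).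
  by have [bl br] := tens_bilinear Y U; split.
by have := HQ _ bQ; rewrite (bilBr bb').
Qed.
End TensorCokernel.

(** * The completed tensor products preserve cokernels *)

Section CompletedMap.
Variables (k : fieldType) (X0 X1 X2 : linTopType k).
Variables (G : lcmap X0 X1) (F : lcmap X1 X2).
Local Notation C := compl_topsc.

Lemma compl_lcmap_to_compl (V W : linTopType k) (H : lcmap V W) v :
  compl_lcmap H (to_compl v) = to_compl (H v).
Proof. exact: compl_map_to_compl. Qed.

(** A cokernel is determined by what happens on dense subspaces, so that it
    can be recognised before completing. *)
Lemma compl_coker :
  (forall x, F (G x) = 0) ->
  (forall z (E : open_submod X2), exists x, F x - z \in E) ->
  (forall E : open_submod X1, (forall x, G x \in E) ->
     exists E' : open_submod X2, forall x, F x \in E' -> x \in E) ->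
  @is_cokernel (TopSC k) (C X0) (C X1) (C X2) (compl_lcmap G) (compl_lcmap F).
Proof.
move=> FG dF sF; apply: coker_intro.
- have e : lcmapM F G = 0 by exact: lcmapP.
  move=> x; have := congr1 (fun m : lcmap (compl X0) (compl X2) => m x)
    (compl_lcmapM F G) => /= <-.
  by rewrite e; apply: complP => P; exact: (raddf0 (vproj P)).
- move=> y R; have [z zR] := to_compl_dense y R.
  have [x xR] := dF z (preim_open (to_compl_lcmap X2) R).
  exists (to_compl x); rewrite compl_lcmap_to_compl.
  by apply: submod_trans zR; rewrite -raddfB; exact: xR.
- move=> P GP; have [x|E' HE'] := sF (preim_open (to_compl_lcmap X1) P).
    rewrite /preim_open mem_preim_submod /= -compl_lcmap_to_compl; exact: GP.
  pose R : open_submod (compl X2) := OpenSubmod (@open_compl_ker _ _ E').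
  exists R => z zR.
  have [T [TP TR]] := open_submodI P (preim_open (compl_lcmap F) R).
  have [x xT] := to_compl_dense z T.
  apply: submod_cong (submod_subC (TP _ xT)) _; apply: (HE' x).
  apply/vproj0; apply/(@compl_kerP _ _ E' (to_compl (F x))).
  rewrite -compl_lcmap_to_compl; apply: submod_cong (zR : _ \in R).
  by have := TR _ xT; rewrite /preim_open mem_preim_submod lcmB.
Qed.

Lemma compl_lcmap_add (H H' : lcmap X1 X2) :
  compl_lcmap (H + H') = compl_lcmap H + compl_lcmap H'.
Proof.
apply: lcmapP => x; apply: complP => Q.
have [P [PH PH']] := open_submodI (preim_open H Q) (preim_open H' Q).
have xP := esym (vreprK (x P)).
rewrite [RHS](_ : _ = compl_map H x Q + compl_map H' x Q) //.
rewrite [LHS](@compl_mapE _ _ _ (H + H') x P Q _ _ xP); last first.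
  by move=> u uP; apply: rpredD; [exact: PH|exact: PH'].
by rewrite (compl_mapE _ xP) ?(compl_mapE _ xP) // -raddfD.
Qed.
End CompletedMap.

Definition additive_functor (C : additive_category) (T : endofunctor C) :=
  forall A B (f g : hom A B), fmap T (f + g) = fmap T f + fmap T g.

Definition preserves_coker (C : additive_category) (T : endofunctor C) :=
  forall A B D (f : hom A B) (c : hom B D),
    is_cokernel f c -> is_cokernel (fmap T f) (fmap T c).

Section TensorFunctors.
Variables (k : fieldType) (t : tensor_kind) (U : TopSC k).

Lemma ctensr_additive : additive_functor (ctensr t U).
Proof.
move=> A B f g; rewrite [RHS](_ : _ = compl_lcmap (tens_lcmap t (lcmap1 (U : topsc k)) f
  + tens_lcmap t (lcmap1 (U : topsc k)) g)).
  congr compl_lcmap; apply: lcmapP; apply: tensor_ext => u b.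
  rewrite [LHS]tens_mapE [RHS](_ : _ = tens u (f b) + tens u (g b)).
    exact: (bilDr (tens_bilinear _ _)).
  by congr (_ + _); exact: tens_mapE.
by rewrite compl_lcmap_add.
Qed.

Lemma ctensl_additive : additive_functor (ctensl t U).
Proof.
move=> A B f g; rewrite [RHS](_ : _ = compl_lcmap (tens_lcmap t f (lcmap1 (U : topsc k))
  + tens_lcmap t g (lcmap1 (U : topsc k)))).
  congr compl_lcmap; apply: lcmapP; apply: tensor_ext => b u.
  rewrite [LHS]tens_mapE [RHS](_ : _ = tens (f b) u + tens (g b) u).
    exact: (bilDl (tens_bilinear _ _)).
  by congr (_ + _); exact: tens_mapE.
by rewrite compl_lcmap_add.
Qed.

(** Right exactness of the completed tensor products, the only property of
    these functors besides additivity that enters the main theorem. *)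
Lemma ctensr_coker : preserves_coker (ctensr t U).
Proof.
move=> A B D f c /coker_elim[cf dc sc]; apply: compl_coker.
- move=> x; have e : lcmapM (tens_lcmap t (lcmap1 (U : topsc k)) c)
      (tens_lcmap t (lcmap1 (U : topsc k)) f) = 0.
    apply: lcmapP; apply: tensor_ext => u a /=.
    by rewrite /tens_top_map !tens_mapE /= cf (bil0r (tens_bilinear _ _)).
  exact: (congr1 (fun m : lcmap _ _ => m x) e).
- exact: tens_dense_r.
- move=> E fE; have /open_tensP oE := osubmod_open E.
  have [|E' [oE' HE']] := tens_strict_r dc sc oE.
    by move=> u a; rewrite -[tens _ _](tens_mapE (lcmap1 (U : topsc k)) f); exact: fE.
  have oE'' : open [set` (E' : submodClosed (tens_top t U D))]%classic.
    exact/open_tensP.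
  by exists (OpenSubmod oE'').
Qed.

Lemma ctensl_coker : preserves_coker (ctensl t U).
Proof.
move=> A B D f c /coker_elim[cf dc sc]; apply: compl_coker.
- move=> x; have e : lcmapM (tens_lcmap t c (lcmap1 (U : topsc k)))
      (tens_lcmap t f (lcmap1 (U : topsc k))) = 0.
    apply: lcmapP; apply: tensor_ext => a u /=.
    by rewrite /tens_top_map !tens_mapE /= cf (bil0l (tens_bilinear _ _)).
  exact: (congr1 (fun m : lcmap _ _ => m x) e).
- exact: tens_dense_l.
- move=> E fE; have /open_tensP oE := osubmod_open E.
  have [|E' [oE' HE']] := tens_strict_l dc sc oE.
    by move=> a u; rewrite -[tens _ _](tens_mapE f (lcmap1 (U : topsc k))); exact: fE.
  have oE'' : open [set` (E' : submodClosed (tens_top t D U))]%classic.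
    exact/open_tensP.
  by exists (OpenSubmod oE'').
Qed.
End TensorFunctors.

(** * Strict short exact sequences *)

Section AdditiveCategory.
Variable C : additive_category.

Lemma comp0m (A B D : C) (f : hom A B) : (0 : hom B D) \oc f = 0.
Proof. by apply: (addrI (0 \oc f)); rewrite -compDl !addr0. Qed.
Lemma compm0 (A B D : C) (g : hom B D) : g \oc (0 : hom A B) = 0.
Proof. by apply: (addrI (g \oc 0)); rewrite -compDr !addr0. Qed.
Lemma compBr (A B D : C) (g : hom B D) (f f' : hom A B) :
  g \oc (f - f') = (g \oc f) - (g \oc f').
Proof. by apply/eqP; rewrite eq_sym subr_eq -compDr subrK. Qed.

Lemma coker_iso (A B D A' B' D' : C) (i : hom A B) (p : hom B D)
    (i' : hom A' B') (p' : hom B' D') (a : hom A A') (b : hom B B') (d : hom D D') :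
  is_iso a -> is_iso b -> is_iso d ->
  b \oc i = i' \oc a -> d \oc p = p' \oc b ->
  is_cokernel i p -> is_cokernel i' p'.
Proof.
move=> [a' [_ aa']] [b' [b'b bb']] [d' [d'd dd']] bi dp [pi0 ui]; split.
  rewrite -[i']compm1 -aa' [i' \oc _]compA -bi -!compA [p' \oc _]compA -dp.
  by rewrite -!compA [p \oc _]compA pi0 comp0m compm0.
move=> X f fi'; have [|h [hE hU]] := ui X (f \oc b).
  by rewrite -compA bi compA fi' comp0m.
exists (h \oc d'); split.
  rewrite -[p']compm1 -bb' [p' \oc _]compA -dp -!compA [d' \oc _]compA.
  by rewrite d'd comp1m compA hE -compA bb' compm1.
move=> g gE; rewrite (hU (g \oc d)); first by rewrite -compA dd' compm1.
by rewrite -compA dp compA gE.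
Qed.

Variable T : endofunctor C.
Hypothesis addT : additive_functor T.

Lemma fmap0 (A B : C) : fmap T (0 : hom A B) = 0.
Proof. by apply: (addrI (fmap T 0)); rewrite -addT !addr0. Qed.
Lemma fmapB (A B : C) (f g : hom A B) : fmap T (f - g) = fmap T f - fmap T g.
Proof. by apply/eqP; rewrite eq_sym subr_eq -addT subrK. Qed.

Lemma fmap_iso (A B : C) (f : hom A B) : is_iso f -> is_iso (fmap T f).
Proof.
by move=> [g [gf fg]]; exists (fmap T g); rewrite -!fmapM gf fg !fmap1.
Qed.

Lemma fmap_biproduct (B1 B2 P : C) (i1 : hom B1 P) (i2 : hom B2 P)
    (p1 : hom P B1) (p2 : hom P B2) :
  is_biproduct i1 i2 p1 p2 ->
  is_biproduct (fmap T i1) (fmap T i2) (fmap T p1) (fmap T p2).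
Proof.
move=> [e1 e2 e3 e4 e5]; split; rewrite -!fmapM ?e1 ?e2 ?e3 ?e4 ?fmap1 ?fmap0 //.
by rewrite -addT e5 fmap1.
Qed.
End AdditiveCategory.

Section Strict.
Variable k : fieldType.
Implicit Types A B D X : topsc k.

Lemma lcm_eq A B (f g : lcmap A B) : f = g -> forall x, f x = g x.
Proof. by move=> ->. Qed.

Lemma embedding_comp A B D (g : lcmap B D) (f : lcmap A B) :
  embedding f -> embedding g -> embedding (lcmapM g f).
Proof.
move=> ef eg P; have [Q HQ] := ef P; have [R HR] := eg Q.
by exists R => a /HR/HQ.
Qed.

Lemma embedding_factor A B D (g : lcmap B D) (f : lcmap A B) :
  embedding (lcmapM g f) -> embedding f.
Proof.
move=> egf P; have [R HR] := egf P; exists (preim_open g R) => a.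
by rewrite /preim_open mem_preim_submod => /HR.
Qed.

Lemma embedding_iso A B (f : lcmap A B) : @is_iso (TopSC k) A B f -> embedding f.
Proof.
move=> [g [gf _]]; apply: (@embedding_factor _ _ _ g).
rewrite (gf : lcmapM g f = lcmap1 A) => P; by exists P.
Qed.

Lemma surjective_iso A B (f : lcmap A B) :
  @is_iso (TopSC k) A B f -> surjective_map f.
Proof. by move=> [g [_ /lcm_eq fg]] y; exists (g y); exact: fg. Qed.

Lemma strict_ses_iso A B D (A' B' D' : topsc k) (i : lcmap A B) (p : lcmap B D)
    (i' : lcmap A' B') (p' : lcmap B' D') (a : lcmap A A') (b : lcmap B B')
    (d : lcmap D D') :
  @is_iso (TopSC k) _ _ a -> @is_iso (TopSC k) _ _ b -> @is_iso (TopSC k) _ _ d ->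
  lcmapM b i = lcmapM i' a -> lcmapM d p = lcmapM p' b ->
  strict_ses i p -> strict_ses i' p'.
Proof.
move=> ia ib isd bi dp [ei cp sp]; split.
- have [a' [aa' a'a]] := ia.
  have -> : i' = lcmapM (lcmapM b i) a'.
    rewrite bi; apply: lcmapP => x /=.
    by rewrite [a (a' x)](lcm_eq a'a).
  apply: embedding_comp; last exact: embedding_comp ei (embedding_iso ib).
  by apply: embedding_iso; exists a.
- exact: (@coker_iso (TopSC k) _ _ _ _ _ _ i p i' p' a b d).
- move=> y; have [y' <-] := surjective_iso isd y; have [x <-] := sp y'.
  by exists (b x); exact: esym (lcm_eq dp x).
Qed.

Lemma strict_ses_mono1 A B D (i : lcmap A B) (p : lcmap B D) :
  @is_iso (TopSC k) A B i -> @is_cokernel (TopSC k) A B D i p -> strict_ses i p.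
Proof.
move=> ii cp; split=> //; first exact: embedding_iso.
have [pi0 dp _] := coker_elim cp.
move=> y; exists 0; rewrite lcm0; apply/esym/topsc_eq0 => R.
have [b bR] := dp y R; have [a ab] := surjective_iso ii b.
by move: bR; rewrite -ab pi0 sub0r => /submodN; rewrite opprK.
Qed.

Lemma strict_ses_epi1 A B D (i : lcmap A B) (p : lcmap B D) :
  lcmap1 A = 0 -> @is_iso (TopSC k) B D p -> @is_cokernel (TopSC k) A B D i p ->
  strict_ses i p.
Proof.
move=> /lcm_eq A0 ip cp; split=> //; last exact: surjective_iso.
have [Q _] := open_submodT B => P; exists Q => a _.
by rewrite [lcmap1 A a]A0 rpred0.
Qed.

Lemma dsum_biproduct (B1 B2 : topsc k) :
  @is_biproduct (TopSC k) B1 B2 (dsum_topsc B1 B2) (linl B1 B2) (linr B1 B2)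
    (lfst B1 B2) (lsnd B1 B2).
Proof.
split; try exact: lcmapP.
by apply: lcmapP => -[a b]; apply/eqP; rewrite -pair_eqE /= addr0 add0r !eqxx.
Qed.

(** Composition of admissible monomorphisms.  The difficulty is to see that r
    is surjective. *)
Lemma strict_ses_comp A B D (Dp Dq : topsc k) X (f : lcmap A B) (p : lcmap B Dp)
    (g : lcmap B D) (q : lcmap D Dq) (r : lcmap D X) :
  strict_ses f p -> strict_ses g q ->
  @is_cokernel (TopSC k) A D X (lcmapM g f) r -> strict_ses (lcmapM g f) r.
Proof.
move=> [ef cp sp] [eg cq sq] cr; split=> //; first exact: embedding_comp.
have [rgf ur] := cr; have [_ up] := cp.
have [|p' [/lcm_eq p'E _]] := up X (lcmapM r g).
  by apply: lcmapP => a; exact: (lcm_eq rgf a).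
(* X is the pushout of g along p, whence the surjectivity of c. *)
pose c : lcmap (dsum_topsc D Dp) X := lcmapM r (lfst D Dp) + lcmapM p' (lsnd D Dp).
have cE x : c x = r x.1 + p' x.2 by [].
pose P := dsum_topsc D Dp.
have cc : @is_cokernel (TopSC k) B P X
    (lcmapM (linl D Dp) g - lcmapM (linr D Dp) p) c.
  have dE b : (lcmapM (linl D Dp) g - lcmapM (linr D Dp) p) b = (g b, - p b).
    by apply/eqP; rewrite -pair_eqE /= oppr0 addr0 add0r !eqxx.
  have [rgf0 dr sr] := coker_elim cr.
  apply: coker_intro.
  - move=> b; rewrite dE cE /= raddfN; apply/eqP; rewrite subr_eq0 eq_sym.
    by apply/eqP; exact: p'E.
  - move=> y R; have [x xR] := dr y R; exists (x, 0).
    by rewrite cE /= raddf0 addr0.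
  - move=> Q HQ; have HQ' b : (g b, - p b) \in Q by rewrite -dE; exact: HQ.
    have [a|R HR] := sr (preim_open (linl D Dp) Q).
      have := HQ' (f a); have [pf0 _ _] := coker_elim cp.
      by rewrite pf0 oppr0.
    exists R => -[x z]; rewrite cE /=; have [b <-] := sp z.
    rewrite [p' (p b)]p'E /= -raddfD => /HR; rewrite /preim_open mem_preim_submod.
    move=> H; have := submodB H (HQ' b).
    rewrite [X in X \in _ -> _](_ : _ = (x, p b)) //.
    by apply/eqP; rewrite -pair_eqE /= addrK opprK add0r !eqxx.
have sc := pushout_surjective eg cq sq (dsum_biproduct D Dp) cc.
move=> y; have [[x z] <-] := sc y; have [b <-] := sp z.
by exists (x + g b); rewrite cE /= [p' (p b)]p'E lcmD.
Qed.

(** The so-called obscure axiom: a morphism n with a cokernel is an admissible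
    monomorphism as soon as some composite a n is.  The pushout of i along n
    is the direct sum of B and D' via the shear (x, y) |-> (x + a y, b y), so
    that b is a component of a surjective map. *)
Lemma strict_ses_obscure A B (B' : topsc k) D (D' : topsc k) (i : lcmap A B) (p : lcmap B D)
    (n : lcmap A B') (b : lcmap B' D') (a : lcmap B' B) :
  strict_ses i p -> lcmapM a n = i -> @is_cokernel (TopSC k) A B' D' n b ->
  strict_ses n b.
Proof.
move=> [ei cp sp] an cb; split=> //; first by apply: (@embedding_factor _ _ _ a); rewrite an.
pose P := dsum_topsc B B'; pose Y := dsum_topsc B D'.
pose c : lcmap P Y := lcmapM (linl B D') (lfst B B' + lcmapM a (lsnd B B')) +
  lcmapM (linr B D') (lcmapM b (lsnd B B')).
have cE x y : c (x, y) = (x + a y, b y).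
  by apply/eqP; rewrite -pair_eqE /= addr0 add0r !eqxx.
have [bn db sb] := coker_elim cb.
have cc : @is_cokernel (TopSC k) A P Y (lcmapM (linl B B') i - lcmapM (linr B B') n) c.
  have dE x : (lcmapM (linl B B') i - lcmapM (linr B B') n) x = (i x, - n x).
    by apply/eqP; rewrite -pair_eqE /= oppr0 addr0 add0r !eqxx.
  have anE x : a (n x) = i x by exact: (lcm_eq an).
  apply: coker_intro.
  - move=> x; by rewrite dE cE !lcmN anE bn subrr oppr0.
  - move=> [x d] R; have [U [W UW]] := open_boxP R; have [y yW] := db d W.
    exists (x - a y, y); rewrite cE subrK; apply/UW/mem_mk_submod.
    by split; rewrite /= ?subrr ?rpred0.
  - move=> Q HQ; have HQ' x : (i x, - n x) \in Q by rewrite -dE; exact: HQ.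
    have [x|W HW] := sb (preim_open (linr B B' - lcmapM (linl B B') a) Q).
      rewrite /preim_open mem_preim_submod.
      rewrite [X in X \in _](_ : _ = - (i x, - n x)); first exact/submodN/HQ'.
      by apply/eqP; rewrite -pair_eqE /= anE opprK oppr0 addr0 add0r !eqxx.
    exists (obox (preim_open (linl B B') Q) W) => -[x y].
    rewrite cE => /mem_mk_submod[/= xQ yW]; have := HW _ yW.
    rewrite /preim_open mem_preim_submod => yQ.
    have := rpredD (xQ : linl B B' (x + a y) \in Q) yQ.
    rewrite [X in X \in _ -> _](_ : _ = (x, y)) //.
    by apply/eqP; rewrite -pair_eqE /= !(oppr0, addr0, add0r, addrK) !eqxx.
have sc := pushout_surjective ei cp sp (dsum_biproduct B B') cc.
move=> d; have [[x y]] := sc ((0, d) : Y); rewrite cE => -[_ <-].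
by exists y.
Qed.

(** Composition of admissible epimorphisms.  Here K is the pullback of p along
    j and A its subspace where l vanishes.  That K is embedded in B follows as
    in the five lemma from the embeddings of A and L. *)
Lemma strict_ses_epi_comp A B D X (K L : topsc k) (i : lcmap A B) (p : lcmap B D)
    (j : lcmap L D) (q : lcmap D X) (n : lcmap A K) (l : lcmap K L) (h : lcmap K B) :
  strict_ses i p -> strict_ses j q -> strict_ses n l ->
  lcmapM p h = lcmapM j l -> lcmapM h n = i -> strict_ses h (lcmapM q p).
Proof.
move=> [ei cp sp] [ej cq sq] [en cl sl] /lcm_eq /= phE /lcm_eq /= hnE.
have [pi0 _ _] := coker_elim cp; have [qj0 _ _] := coker_elim cq.
have [ln0 _ _] := coker_elim cl.
have sqp : surjective_map (lcmapM q p).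
  by move=> y; have [d <-] := sq y; have [b <-] := sp d; exists b.
split=> //.
- move=> P; have [S HS] := ei (preim_open n P).
  have [P' [P'P P'S]] := open_submodI P (preim_open h S).
  have [V HV] := coker_open cl sl P'; have [W HW] := ej V.
  have [R [RS RW]] := open_submodI S (preim_open p W).
  exists R => x xR /=; have := RW _ xR; rewrite /preim_open mem_preim_submod phE.
  (* x and the small x' have the same image in L, so x - x' comes from A, and
     it is small since its image in B is. *)
  move=> /HW/HV[x' x'P' lx].
  have [|a na] := @embedding_coker_ker _ _ _ _ n l (x - x') en cl.
    by rewrite lcmB lx subrr.
  have iaS : i a \in S.
    rewrite -hnE na lcmB; apply: submodB (RS _ xR) _.
    by have := P'S _ x'P'; rewrite /preim_open mem_preim_submod.
  have := HS _ iaS; rewrite /preim_open mem_preim_submod /= na => xx'.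
  exact: submod_cong xx' (P'P _ x'P').
- apply: open_coker_intro => //.
  + by move=> x /=; rewrite phE qj0.
  + move=> b /= qpb; have [y jy] := embedding_coker_ker ej cq qpb.
    have [x lx] := sl y.
    have [|a ia] := @embedding_coker_ker _ _ _ _ i p (b - h x) ei cp.
      by rewrite lcmB phE lx jy subrr.
    by exists (x + n a); rewrite lcmD hnE ia addrC subrK.
  + move=> P; have [Q HQ] := coker_open cp sp P; have [R HR] := coker_open cq sq Q.
    by exists R => y /HR[d /HQ[b bP <-] <-]; exists b.
Qed.
End Strict.

(** * The largest stable exact structure *)

Section PushoutSquare.
Variables (C : additive_category) (A B X P Y : C) (f : hom A B) (g : hom A X).
Variables (i1 : hom B P) (i2 : hom X P) (p1 : hom P B) (p2 : hom P X) (c : hom P Y).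
Hypothesis bi : is_biproduct i1 i2 p1 p2.
Hypothesis cc : is_cokernel ((i1 \oc f) - (i2 \oc g)) c.

Lemma coker_pushout : is_pushout f g (c \oc i2) (c \oc i1).
Proof.
have [e1 e2 e3 e4 e5] := bi; have [c0 uc] := cc; split.
  by apply/eqP; rewrite -!compA -subr_eq0 -compBr c0.
move=> Z u v uv; pose w0 := (u \oc p1) + (v \oc p2).
have w1 : w0 \oc i1 = u by rewrite /w0 compDl -!compA e1 e4 compm1 compm0 addr0.
have w2 : w0 \oc i2 = v by rewrite /w0 compDl -!compA e2 e3 compm1 compm0 add0r.
have [|w [wc wU]] := uc Z w0; first by rewrite compBr !compA w1 w2 uv subrr.
exists w; split; first by rewrite !compA wc.
move=> w' [w'1 w'2]; apply: wU.
by rewrite -[w' \oc c]compm1 -e5 compDr !compA -2![w' \oc c \oc _]compA w'1 w'2.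
Qed.
End PushoutSquare.

Section Pullback.
Variable k : fieldType.
Local Notation C := (TopSC k).

(** D is also the cokernel of X -> Y, by the universal property of the
    pushout. *)
Lemma strict_ses_pushout (A B X D P Y : topsc k) (f : lcmap A B) (g : lcmap A X)
    (p : lcmap B D) (i1 : lcmap B P) (i2 : lcmap X P) (p1 : lcmap P B)
    (p2 : lcmap P X) (c : lcmap P Y) (q : lcmap Y D) :
  strict_ses f p -> @is_biproduct C B X P i1 i2 p1 p2 ->
  @is_cokernel C A P Y (lcmapM i1 f - lcmapM i2 g) c ->
  lcmapM q (lcmapM c i2) = 0 -> lcmapM q (lcmapM c i1) = p ->
  strict_ses (lcmapM c i2) q.
Proof.
move=> [ef cp sp] bi cc /lcm_eq q2 q1.
have po := @coker_pushout C _ _ _ _ _ _ _ _ _ _ _ _ bi cc.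
have [poE upo] := po.
have sq : surjective_map q.
  by move=> y; have [x <-] := sp y; exists (c (i1 x)); rewrite -q1.
split=> //; first exact: (pushout_embedding ef bi cc).
split; first exact: lcmapP.
move=> Z v va; have [_ up] := cp.
have [|w [wE wU]] := up Z (lcmapM v (lcmapM c i1)).
  by apply: lcmapP => x; rewrite -[RHS](lcm_eq va (g x)) /= [c _](lcm_eq poE).
exists w; split; last first.
  by move=> w' w'E; apply: wU; rewrite -q1 -w'E; exact: lcmapP.
have [|w0 [_ w0U]] := upo Z (lcmapM v (lcmapM c i1)) 0.
  by apply: lcmapP => x; rewrite -[RHS](lcm_eq va (g x)) /= [c _](lcm_eq poE).
have e1 : w0 = lcmapM w q.
  apply: w0U; split.
    by apply: lcmapP => x; rewrite -[RHS](lcm_eq wE) /= -[in RHS]q1.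
  by apply: lcmapP => x; rewrite /= [q _](q2 x) raddf0.
by rewrite -[RHS](w0U v) // e1.
Qed.

(** The pullback is a kernel of B (+) D' -> D.  Surjective open maps are stable
    under pullback, and b is one, so it is the cokernel of its kernel n. *)
Lemma pullback_exists (A B D D' : topsc k) (i : lcmap A B) (p : lcmap B D)
    (g : lcmap D' D) :
  strict_ses i p -> exists (K : topsc k) (a : lcmap K B) (b : lcmap K D') (n : lcmap A K),
    [/\ @is_pullback C B D D' K p g a b, lcmapM a n = i & @is_cokernel C A K D' n b].
Proof.
move=> [ei cp sp]; have [pi0 _ _] := coker_elim cp.
pose P := dsum_topsc B D'.
pose h : lcmap P D := lcmapM p (lfst B D') - lcmapM g (lsnd B D').
have hE x : h x = p x.1 - g x.2 by [].
pose K := ker_topsc h; pose e := ker_lcmap h.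
have eK : @is_kernel C K P D e h.
  exact: kernel_intro (ker_embedding (h := h)) (@ker_lcmap0 _ _ _ h) (@ker_lcmap_ex _ _ _ h).
have [he ue] := eK.
pose a : lcmap K B := lcmapM (lfst B D') e; pose b : lcmap K D' := lcmapM (lsnd B D') e.
have pagb x : p (a x) = g (b x) by apply/subr0_eq; exact: (ker_lcmap0 x).
have [|n [/lcm_eq nE _]] := ue A (lcmapM (linl B D') i).
  by apply: lcmapP => x; rewrite /= raddf0 subr0 pi0.
have anE x : a (n x) = i x by rewrite /a /= [e _]nE.
have bnE x : b (n x) = 0 by rewrite /b /= [e _]nE.
exists K, a, b, n; split.
- split; first exact: lcmapP.
  move=> Z u v /lcm_eq uv.
  have [|w [/lcm_eq wE wU]] := ue Z (lcmapM (linl B D') u + lcmapM (linr B D') v).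
    apply: lcmapP => x; rewrite /= addr0 add0r; apply/eqP; rewrite subr_eq0.
    by apply/eqP; exact: uv.
  exists w; split.
    split; apply: lcmapP => x; rewrite /a /b /= [e _]wE /= ?addr0 ?add0r //.
  move=> w' [/lcm_eq wa /lcm_eq wb]; apply: wU; apply: lcmapP => x.
  by apply/eqP; rewrite -pair_eqE /= addr0 add0r -wa -wb !eqxx.
- exact: lcmapP.
- have lift x y : p x = g y -> exists z, a z = x /\ b z = y.
    move=> e1; have [|z ze] := @ker_lcmap_ex _ _ _ h (x, y).
      by rewrite hE e1 subrr.
    by exists z; rewrite /a /b /= [e _]ze.
  apply: open_coker_intro => //.
  + move=> z bz; have paz : p (a z) = 0 by rewrite pagb bz raddf0.
    have [x ix] := embedding_coker_ker ei cp paz; exists x.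
    apply/subr0_eq/(embedding_inj (ker_embedding (h := h))).
    rewrite lcmB -/e [e (n x)]nE; apply/eqP.
    rewrite -pair_eqE /= -[(e z).1]/(a z) -[(e z).2]/(b z) bz ix !subrr !eqxx; by [].
  + move=> y; have [x e1] := sp (g y); have [z [_ <-]] := lift _ _ e1.
    by exists z.
  + move=> Q; have [R HR] := ker_embedding (h := h) Q.
    have [U [W UW]] := open_boxP R; have [V HV] := coker_open cp sp U.
    have [T [TW TV]] := open_submodI W (preim_open g V).
    exists T => y yT; have := TV _ yT; rewrite /preim_open mem_preim_submod.
    move=> /HV[x xU e1]; have [z [az bz]] := lift _ _ e1; exists z => //.
    apply: HR; apply: UW; apply/mem_mk_submod; split.
      by rewrite -[X in X \in _]/(a z) az.
    by rewrite -[X in X \in _]/(b z) bz; exact: TW.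
Qed.
End Pullback.

Section Largest.
Variables (k : fieldType) (J : Type) (T : J -> endofunctor (TopSC k)).
Hypothesis addT : forall j, additive_functor (T j).
Hypothesis cokT : forall j, preserves_coker (T j).
Local Notation C := (TopSC k).

(** The strict short exact sequences that remain strict under all composites of
    the functors T j, obtained as the union of all T-stable classes of strict
    sequences.  To show that a sequence belongs to it, one exhibits such a
    class: a diagram shape that contains the sequence, forces it to be strict,
    and is preserved by additive functors that preserve cokernels. *)
Definition stable_strict : seq_class C := fun A B D i p =>
  exists S : seq_class C,
    [/\ sub_class S (@strict_ses k), forall j, exact_functor S (T j) & S A B D i p].

Lemma stable_strictS : sub_class stable_strict (@strict_ses k).
Proof. by move=> A B D i p [S [sS _ /sS]]. Qed.

Lemma stable_strictT j : exact_functor stable_strict (T j).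
Proof. by move=> A B D i p [S [sS TS Sip]]; exists S; split=> //; exact: TS. Qed.

Lemma stable_strict_iso (A B D A' B' D' : C) (i : hom A B) (p : hom B D)
    (i' : hom A' B') (p' : hom B' D') (a : hom A A') (b : hom B B') (d : hom D D') :
  is_iso a -> is_iso b -> is_iso d -> b \oc i = i' \oc a -> d \oc p = p' \oc b ->
  stable_strict i p -> stable_strict i' p'.
Proof.
move=> ia ib isd bi dp Eip.
exists (fun A' B' D' i' p' => exists A B D (i : hom A B) (p : hom B D)
  (a : hom A A') (b : hom B B') (d : hom D D'),
  [/\ is_iso a, is_iso b, is_iso d
    & [/\ b \oc i = i' \oc a, d \oc p = p' \oc b & stable_strict i p]]).
split.
- move=> ? ? ? ? ? [? [? [? [? [? [? [? [? []]]]]]]]].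
  move=> {}ia {}ib {}isd [{}bi {}dp /stable_strictS].
  exact: strict_ses_iso ia ib isd bi dp.
- move=> j ? ? ? ? ? [A1 [B1 [D1 [i1 [p1 [a1 [b1 [d1 []]]]]]]]].
  move=> {}ia {}ib {}isd [{}bi {}dp E]; exists (T j A1), (T j B1), (T j D1).
  exists (fmap (T j) i1), (fmap (T j) p1), (fmap (T j) a1), (fmap (T j) b1), (fmap (T j) d1).
  split; [exact: fmap_iso|exact: fmap_iso|exact: fmap_iso|].
  by split; [rewrite -!fmapM bi|rewrite -!fmapM dp|exact: stable_strictT].
- by exists A, B, D, i, p, a, b, d.
Qed.

Lemma stable_strict_mono1 (A B D : C) (i : hom A B) (p : hom B D) :
  is_iso i -> is_cokernel i p -> stable_strict i p.
Proof.
move=> ii cp; exists (fun A B D i p => is_iso i /\ is_cokernel i p); split=> //.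
- by move=> ? ? ? ? ? [{}ii {}cp]; exact: strict_ses_mono1.
- move=> j ? ? ? ? ? [{}ii {}cp].
  by split; [exact: fmap_iso|exact: cokT].
Qed.

Lemma stable_strict_epi1 (A B D : C) (i : hom A B) (p : hom B D) :
  idm A = 0 -> is_iso p -> is_cokernel i p -> stable_strict i p.
Proof.
move=> A0 ip cp.
exists (fun A B D i p => [/\ idm A = 0, is_iso p & is_cokernel i p]); split=> //.
- by move=> ? ? ? ? ? [{}A0 {}ip {}cp]; exact: strict_ses_epi1.
- move=> j ? ? ? ? ? [{}A0 {}ip {}cp].
  by split; [rewrite -fmap1 A0 fmap0|exact: fmap_iso|exact: cokT].
Qed.

Lemma stable_strict_comp (A B D Dp Dq X : C) (f : hom A B) (p : hom B Dp)
    (g : hom B D) (q : hom D Dq) (r : hom D X) :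
  stable_strict f p -> stable_strict g q -> is_cokernel (g \oc f) r ->
  stable_strict (g \oc f) r.
Proof.
move=> Ef Eg cr.
exists (fun A D X h r => exists B (f : hom A B) (g : hom B D) Dp (p : hom B Dp)
  Dq (q : hom D Dq), [/\ h = g \oc f, stable_strict f p, stable_strict g q
    & is_cokernel h r]); split.
- move=> ? ? ? h ? [? [? [? [? [? [? [? [-> ]]]]]]]].
  by move=> /stable_strictS {}Ef /stable_strictS {}Eg; exact: strict_ses_comp Ef Eg.
- move=> j ? ? ? h ? [B1 [f1 [g1 [Dp1 [p1 [Dq1 [q1 [-> {}Ef {}Eg {}cr]]]]]]]].
  exists (T j B1), (fmap (T j) f1), (fmap (T j) g1), (T j Dp1), (fmap (T j) p1).
  exists (T j Dq1), (fmap (T j) q1).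
  split; [exact: fmapM|exact: stable_strictT|exact: stable_strictT|exact: cokT].
- by exists B, f, g, Dp, p, Dq, q.
Qed.

Lemma stable_strict_obscure (A B B' D D' : C) (i : hom A B) (p : hom B D)
    (n : hom A B') (b : hom B' D') (a : hom B' B) :
  stable_strict i p -> a \oc n = i -> is_cokernel n b -> stable_strict n b.
Proof.
move=> Ei an cb.
exists (fun A B' D' n b => exists B D (i : hom A B) (p : hom B D) (a : hom B' B),
  [/\ stable_strict i p, a \oc n = i & is_cokernel n b]); split.
- move=> ? ? ? ? ? [? [? [? [? [? [/stable_strictS {}Ei {}an {}cb]]]]]].
  exact: strict_ses_obscure Ei an cb.
- move=> j ? ? ? ? ? [B1 [D1 [i1 [p1 [a1 [{}Ei {}an {}cb]]]]]].
  exists (T j B1), (T j D1), (fmap (T j) i1), (fmap (T j) p1), (fmap (T j) a1).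
  by split; [exact: stable_strictT|rewrite -fmapM an|exact: cokT].
- by exists B, D, i, p, a.
Qed.

Lemma stable_strict_pushout (A B X D P Y : C) (f : hom A B) (g : hom A X)
    (p : hom B D) (i1 : hom B P) (i2 : hom X P) (p1 : hom P B)
    (p2 : hom P X) (c : hom P Y) (q : hom Y D) :
  stable_strict f p -> is_biproduct i1 i2 p1 p2 ->
  is_cokernel ((i1 \oc f) - (i2 \oc g)) c ->
  q \oc (c \oc i2) = 0 -> q \oc (c \oc i1) = p -> stable_strict (c \oc i2) q.
Proof.
move=> Ef bi cc q2 q1.
exists (fun X Y D a q => exists A B P (f : hom A B) (g : hom A X) (p : hom B D)
  (i1 : hom B P) (i2 : hom X P) (p1 : hom P B) (p2 : hom P X) (c : hom P Y),
  [/\ stable_strict f p, is_biproduct i1 i2 p1 p2,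
      is_cokernel ((i1 \oc f) - (i2 \oc g)) c,
      a = c \oc i2 & q \oc a = 0 /\ q \oc (c \oc i1) = p]); split.
- move=> ? ? ? a ? [? [? [? [? [? [? [? [? [? [? [? []]]]]]]]]]]].
  move=> /stable_strictS {}Ef {}bi {}cc -> [{}q2 {}q1].
  exact: strict_ses_pushout Ef bi cc q2 q1.
- move=> j ? ? ? a ?.
  move=> [A1 [B1 [P1 [f' [g' [p' [i1' [i2' [p1' [p2' [c' []]]]]]]]]]]].
  move=> {}Ef {}bi {}cc -> [{}q2 {}q1].
  exists (T j A1), (T j B1), (T j P1), (fmap (T j) f'), (fmap (T j) g'), (fmap (T j) p').
  exists (fmap (T j) i1'), (fmap (T j) i2'), (fmap (T j) p1'), (fmap (T j) p2'), (fmap (T j) c').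
  split.
  + exact: stable_strictT.
  + exact: fmap_biproduct.
  + by rewrite -!fmapM -fmapB //; exact: cokT.
  + exact: fmapM.
  + by rewrite -!fmapM q2 q1 fmap0.
- by exists A, B, P, f, g, p, i1, i2, p1, p2, c.
Qed.

Lemma stable_strict_epi_comp (A B D X K L : C) (i : hom A B) (p : hom B D)
    (j : hom L D) (q : hom D X) (n : hom A K) (l : hom K L) (h : hom K B) :
  stable_strict i p -> stable_strict j q -> stable_strict n l ->
  p \oc h = j \oc l -> h \oc n = i -> stable_strict h (q \oc p).
Proof.
move=> Ei Ej En ph hn.
exists (fun K B X h s => exists A D L (i : hom A B) (p : hom B D)
    (j : hom L D) (q : hom D X) (n : hom A K) (l : hom K L),
  [/\ stable_strict i p, stable_strict j q, stable_strict n l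
    & [/\ p \oc h = j \oc l, h \oc n = i & s = q \oc p]]); split.
- move=> ? ? ? ? s [? [? [? [? [? [? [? [? [? []]]]]]]]]].
  move=> /stable_strictS {}Ei /stable_strictS {}Ej /stable_strictS {}En [{}ph {}hn ->].
  exact: strict_ses_epi_comp Ei Ej En ph hn.
- move=> t ? ? ? ? s.
  move=> [A1 [D1 [L1 [i' [p' [j' [q' [n' [l' []]]]]]]]]] {}Ei {}Ej {}En [{}ph {}hn ->].
  exists (T t A1), (T t D1), (T t L1), (fmap (T t) i'), (fmap (T t) p'), (fmap (T t) j').
  exists (fmap (T t) q'), (fmap (T t) n'), (fmap (T t) l').
  split; [exact: stable_strictT|exact: stable_strictT|exact: stable_strictT|].
  by rewrite -!fmapM ph hn.
- by exists A, D, L, i, p, j, q, n, l.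
Qed.

Lemma topsc_coker (A B : C) (f : hom A B) : exists (Y : C) (c : hom B Y), is_cokernel f c.
Proof.
by have [Y [c [c0 dc sc]]] := coker_exists f; exists Y, c; exact: coker_intro.
Qed.

Lemma stable_strict_pullback (A B D D' : C) (i : hom A B) (p : hom B D) (g : hom D' D) :
  stable_strict i p -> exists (K : C) (a : hom K B) (b : hom K D') (n : hom A K),
    [/\ is_pullback p g a b, a \oc n = i & stable_strict n b].
Proof.
move=> Ei; have [K [a [b [n [pb an cb]]]]] := pullback_exists g (stable_strictS Ei).
by exists K, a, b, n; split=> //; exact: stable_strict_obscure Ei an cb.
Qed.

(** The T j preserve cokernels, which are therefore allowed in the shapes
    above; that a kernel is preserved is in each case a consequence of
    strictness of the resulting sequence. *)
Lemma stable_strict_exact : exact_structure stable_strict.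
Proof.
split.
- move=> A B D i p /stable_strictS[ei cp _]; have [pi0 _ _] := coker_elim cp.
  by apply: kernel_intro => // b; exact: embedding_coker_ker.
- by move=> A B D i p /stable_strictS[].
- exact: stable_strict_iso.
- move=> A; have [Y [c cc]] := topsc_coker (idm A); exists Y, c.
  by apply: stable_strict_mono1 => //; exists (idm A); rewrite comp1m.
- move=> A; have [Z Z0] := zero_object C; exists Z, 0.
  apply: stable_strict_epi1 => //; first by exists (idm A); rewrite comp1m.
  split; first by rewrite compm0.
  by move=> X f _; exists f; split=> [|g <-]; rewrite compm1.
- move=> A B D g f [Df [p Ef]] [Dg [q Eg]].
  have [Y [r cr]] := topsc_coker (g \oc f); exists Y, r.
  exact: stable_strict_comp Ef Eg cr.
- move=> B D X q p [A [i Ei]] [L [j Ej]].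
  have [K [a [b [n [[pb _] an En]]]]] := stable_strict_pullback j Ei.
  by exists K, a; exact: stable_strict_epi_comp Ei Ej En pb an.
- move=> A B X f g [D [p Ef]].
  have [P [i1 [i2 [p1 [p2 bi]]]]] := biproduct B X.
  have {}bi : is_biproduct i1 i2 p1 p2 by [].
  have [Y [c cc]] := topsc_coker ((i1 \oc f) - (i2 \oc g)).
  have po := coker_pushout bi cc.
  exists Y, (c \oc i2), (c \oc i1); split=> //.
  have [_ up] := po; have [|q [[q1 q2] _]] := up D p 0.
    by have [_ [pf0 _] _] := stable_strictS Ef; rewrite comp0m.
  by exists D, q; exact: stable_strict_pushout Ef bi cc q2 q1.
- move=> B D D' p g [A [i Ei]].
  have [K [a [b [n [pb _ En]]]]] := stable_strict_pullback g Ei.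
  by exists K, a, b; split=> //; exists A, n.
Qed.

Lemma stable_strict_largest (F : seq_class C) :
  exact_structure F -> (forall j, exact_functor F (T j)) -> sub_class F stable_strict.
Proof.
move=> eF TF A B D i p Fip; exists F; split=> //.
exact: exact_structure_strict.
Qed.
End Largest.

Lemma exists_unique_maximal (C : additive_category) (P : seq_class C -> Prop)
    (E : seq_class C) :
  P E -> (forall F, P F -> sub_class F E) -> exists! E, maximal_among P E.
Proof.
move=> PE maxE; exists E; split; first by split=> // F /maxE.
move=> F [PF maxF]; have FE := maxE F PF; have EF := maxF E PE FE.
apply: functional_extensionality_dep => A.
apply: functional_extensionality_dep => B.
apply: functional_extensionality_dep => D.
apply/funext => i; apply/funext => p; apply/propext; split.
  exact: EF.
exact: FE.
Qed.

(** All the endofunctors in question as a single family; the boolean tells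
    whether the argument is the left factor. *)
Definition tensor_functor (k : fieldType) (x : tensor_kind * bool * TopSC k) :=
  let: (t, l, U) := x in if l then ctensl t U else ctensr t U.

Theorem proposition13p10 (k : fieldType) :
  exists! E : seq_class (TopSC k),
    maximal_among
      (fun F : seq_class (TopSC k) =>
         [/\ exact_structure F, bifunctor_exact Star F,
             bifunctor_exact Arrow F & bifunctor_exact Bang F]) E.
Proof.
have addT x : additive_functor (@tensor_functor k x).
  by case: x => [[t []] U]; [exact: ctensl_additive|exact: ctensr_additive].
have cokT x : preserves_coker (@tensor_functor k x).
  by case: x => [[t []] U]; [exact: ctensl_coker|exact: ctensr_coker].
apply: (exists_unique_maximal (E := stable_strict (@tensor_functor k))).
  split; first exact: stable_strict_exact.
  - move=> U; split; first exact: (@stable_strictT _ _ _ (Star, false, U)).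
    exact: (@stable_strictT _ _ _ (Star, true, U)).
  - move=> U; split; first exact: (@stable_strictT _ _ _ (Arrow, false, U)).
    exact: (@stable_strictT _ _ _ (Arrow, true, U)).
  - move=> U; split; first exact: (@stable_strictT _ _ _ (Bang, false, U)).
    exact: (@stable_strictT _ _ _ (Bang, true, U)).
move=> F [eF Fs Fa Fb]; apply: stable_strict_largest => //.
by case=> [[[] []] U]; have [] := (Fs U, Fa U, Fb U) => -[[? ?] [? ?]] [? ?].
Qed.
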